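(* Let $\mathcal{K}\subseteq\mathbb{R}^n$ be a convex body symmetric with respect to a point $o$, and let $m\ge0$ be an integer. Then $\psi_m(\mathcal{K})\ge\psi_m(\mathbb{B}_2^n)$.
   Context: A convex body is a compact convex set with nonempty interior. A set $\mathcal{K}$ is $o$-symmetric if $x\in\mathcal{K}$ implies $2o-x\in\mathcal{K}$. For an $o$-symmetric convex body $\mathcal{K}$, $\psi_m(\mathcal{K})=\sup\{\operatorname{vol}\mathcal{P}/\operatorname{vol}\mathcal{K}\colon \mathcal{P}\subset\mathcal{K}\text{ a convex polytope with at most } m \text{ vertices that is } o\text{-symmetric}\}$. $\mathbb{B}_2^n$ is the Euclidean unit ball, considered as symmetric about its center (the origin). *)

(* Defs.v *)
From HB Require Import structures.
From mathcomp Require Import all_boot all_order all_algebra.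
From mathcomp Require Import all_classical all_reals all_analysis.
Set Implicit Arguments. Unset Strict Implicit. Unset Printing Implicit Defensive.
Import Order.TTheory GRing.Theory Num.Theory.
Import numFieldNormedType.Exports.
Local Open Scope classical_set_scope.
Local Open Scope ring_scope.

(* Points of R^n are row vectors 'rV[R]_n; the topology is the canonical
   (product / max-norm) topology of MathComp-Analysis, equivalent to the
   Euclidean one. *)

Section Geom.
Variables (R : realType) (n : nat).
Notation V := 'rV[R]_n.

Definition convex_set (A : set V) : Prop :=
  forall x y (t : R), A x -> A y -> 0 <= t -> t <= 1 -> A (t *: x + (1 - t) *: y).

Definition convex_body (K : set V) : Prop :=
  [/\ convex_set K, compact K & (interior K !=set0)].

Definition sym_about (o : V) (A : set V) : Prop :=
  forall x, A x -> A (2 *: o - x).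

Definition conv_hull (k : nat) (v : 'I_k -> V) : set V :=
  [set x | exists l : 'I_k -> R, (forall i, 0 <= l i) /\ \sum_(i < k) l i = 1
           /\ x = \sum_(i < k) l i *: v i].

Definition polytope_le (m : nat) (P : set V) : Prop :=
  exists k (v : 'I_k -> V), (k <= m)%N /\ P = conv_hull v.

Definition box (a b : V) : set V := [set x | forall i, a 0 i <= x 0 i <= b 0 i].
Definition box_vol (a b : V) : R := \prod_(i < n) (b 0 i - a 0 i).

Definition vol (A : set V) : \bar R :=
  ereal_inf [set s : \bar R | exists (a b : nat -> V),
     [/\ (forall k i, a k 0 i <= b k 0 i),
         A `<=` \bigcup_k box (a k) (b k) &
         s = (\sum_(0 <= k <oo) (box_vol (a k) (b k))%:E)%E]].

Definition psi (m : nat) (K : set V) (o : V) : \bar R :=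
  ereal_sup [set r : \bar R | exists P : set V,
     [/\ polytope_le m P, P `<=` K, sym_about o P &
         r = (fine (vol P) / fine (vol K))%:E]].

Definition unit_ball : set V := [set x | \sum_(i < n) (x 0 i) ^+ 2 <= 1].

End Geom.

(* Main.v *)
From HB Require Import structures.
From mathcomp Require Import all_boot all_order all_algebra.
From mathcomp Require Import fingroup perm.
From mathcomp Require Import all_classical all_reals all_analysis.
From mathcomp Require Import measurable_realfun.
From mathcomp Require Import ring lra.
Import Order.TTheory GRing.Theory Num.Theory.
Import numFieldNormedType.Exports.
Require Import Defs.
Set Implicit Arguments. Unset Strict Implicit. Unset Printing Implicit Defensive.
Local Open Scope classical_set_scope.
Local Open Scope ring_scope.

(** Steiner symmetrization does not increase psi_m. If P is a symmetric polytope
    inside the symmetral of K along u, its vertices can be moved parallel to u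
    into K in two ways (the second one being a mirror image), and on every line
    parallel to u the two resulting polytopes have together chords at least
    twice as long as P; by Tonelli one of them has at least the volume of P.
    Minimality of the vertex set makes it symmetric, so that the displacements
    can be chosen odd and the new polytopes are again symmetric.

    Finitely many symmetrizations bring K between two concentric balls of ratio
    1 - e. A body inside the ball of radius rho that does not contain the ball of
    radius (1 - e) rho misses a cap of the sphere; symmetrizing along z0 - z also
    removes the mirror cap around z, so after running through a finite net of the
    sphere the body fits into a ball smaller by a definite amount. *)

(** The bound is wanted only up to a factor tending to 1, so a pair of concentric balls with ratio
    [1 - e] of radii takes the place of a limit of bodies. Two obstacles shape the rest. [vol] is an
    outer volume given by covers with boxes, while comparing chords means integrating; hence
    Lebesgue measure is built on tuples by recursion and shown to agree with [vol] on compact sets.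
    And lines of arbitrary direction have to be straightened: the direction is scaled to have some
    coordinate equal to 1, then a permutation of coordinates and a shear turn it into a basis
    vector. The volume of the body is a denominator: it must not shrink under symmetrization, and in
    the end it is bounded above by that of the outer ball. *)

(** * Lebesgue measure on tuples, with both orders of integration *)

Section NDimLebesgue.
Variable R : realType.
Notation T n := (n.-tuple (measurableTypeR R)).
Notation lambda := (@lebesgue_measure R).

Definition cons_pair n (p : measurableTypeR R * T n) : T n.+1 := [tuple of p.1 :: p.2].
Definition uncons_pair n (t : T n.+1) : measurableTypeR R * T n := (thead t, [tuple of behead t]).

Lemma measurable_cons_pair n : measurable_fun setT (@cons_pair n).
Proof. exact: measurable_cons. Qed.

Lemma measurable_uncons_pair n : measurable_fun setT (@uncons_pair n).
Proof.
apply: measurable_fun_pair; last exact: measurable_behead.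
exact: (@measurable_tnth _ _ _ ord0).
Qed.

Lemma cons_pairK n : cancel (@cons_pair n) (@uncons_pair n).
Proof. by case=> x t; rewrite /uncons_pair /cons_pair /= theadE; congr pair; apply: val_inj. Qed.

Section Step.
Variables (n : nat) (m : {sigma_finite_measure set (T n) -> \bar R}).
Definition leb_step := pushforward (lambda \x m)%E (@cons_pair n).

(* Must be in the context: [done] uses it for the premise of the pushforward instance. *)
Let mcons := @measurable_cons_pair n.

Let leb_step0 : leb_step set0 = 0%E.
Proof. by rewrite /leb_step /pushforward preimage_set0 measure0. Qed.

Let leb_step_ge0 A : (0 <= leb_step A)%E.
Proof. exact: measure_ge0. Qed.

Let leb_step_sigma_additive : semi_sigma_additive leb_step.
Proof. exact: measure_semi_sigma_additive. Qed.

HB.instance Definition _ := isMeasure.Build _ _ _ leb_step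
  leb_step0 leb_step_ge0 leb_step_sigma_additive.

(** Both product measures and Tonelli ask for sigma-finite factors, so the recursion must preserve
    this. Products of exhausting sets are pulled back along the inverse of [cons_pair]. *)
Lemma leb_step_sigma_finite : sigma_finite setT leb_step.
Proof.
have /sigma_finiteP[F [TF ndF Foo]] := sigma_finiteT lambda.
have /sigma_finiteP[G [TG ndG Goo]] := sigma_finiteT m.
exists (fun k => @uncons_pair n @^-1` (F k `*` G k)).
  rewrite -preimage_bigcup (_ : \bigcup_k _ = setT) ?preimage_setT//.
  rewrite -setXTT TF TG predeqE => -[x y]; split.
    by move=> [k _ []/= ? ?]; split; exists k.
  move=> [/= [k _ Fkx] [l _ Gly]]; exists (maxn k l) => //; split.
  - by move: x Fkx; exact/subsetPset/ndF/leq_maxl.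
  - by move: y Gly; exact/subsetPset/ndG/leq_maxr.
move=> k; have [mF Fk] := Foo k; have [mG Gk] := Goo k; split.
  by rewrite -[X in measurable X]setTI; apply: measurable_uncons_pair => //; exact: measurableX.
rewrite /leb_step /pushforward -comp_preimage.
rewrite (_ : _ \o _ = id) ?preimage_id; last by apply/funext => p /=; rewrite cons_pairK.
by rewrite product_measure1E// lte_mul_pinfty// ge0_fin_numE.
Qed.

HB.instance Definition _ :=
  Measure_isSigmaFinite.Build _ _ _ leb_step leb_step_sigma_finite.
End Step.

(** The unit mass at the empty tuple gives the empty product of lengths its value 1. *)
Fixpoint leb n : {sigma_finite_measure set (T n) -> \bar R} :=
  match n with
  | 0 => \d_([tuple] : T 0)
  | n.+1 => leb_step (leb n)
  end.

Lemma leb_sliceE n (A : set (T n.+1)) : measurable A ->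
  leb n.+1 A = (\int[lambda]_s leb n [set y | A (cons_pair (s, y))])%E.
Proof.
move=> mA; rewrite /= /leb_step /pushforward /product_measure1 /=.
by apply: eq_integral => s _ /=; congr (leb n _); apply/seteqP; split=> y /=; rewrite /xsection /= inE.
Qed.

(** The second order of integration comes from uniqueness: [product_measure2] has the same values on
    rectangles. Slices serve the shear, fibers the comparison of chords. *)
Lemma leb_fiberE n (A : set (T n.+1)) : measurable A ->
  leb n.+1 A = (\int[leb n]_y lambda [set s | A (cons_pair (s, y))])%E.
Proof.
move=> mA; rewrite /= /leb_step /pushforward.
have mA' : measurable (@cons_pair n @^-1` A).
  by rewrite -[X in measurable X]setTI; exact: measurable_cons_pair.
rewrite (@product_measure_unique _ _ _ _ _ _ _ (product_measure2 lambda (leb n)))//; last first.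
  by move=> ? ? ? ?; exact: product_measure2E.
by apply: eq_integral => s _ /=; congr (lambda _); apply/seteqP; split=> y /=; rewrite /ysection /= inE.
Qed.

Lemma measurable_fiber n (A : set (T n.+1)) : measurable A ->
  measurable_fun setT (lambda \o (fun y => [set s | A (cons_pair (s, y))])).
Proof.
move=> mA.
have mA' : measurable (@cons_pair n @^-1` A).
  by rewrite -[X in measurable X]setTI; exact: measurable_cons_pair.
have := @measurable_fun_ysection _ _ _ _ R lambda _ mA'.
congr (measurable_fun _ _); apply/funext => s /=.
by congr (lambda _); apply/seteqP; split=> y /=; rewrite /ysection /= inE.
Qed.

Lemma leb_prod n (X : 'I_n -> set (measurableTypeR R)) : (forall i, measurable (X i)) ->
  measurable [set t : T n | forall i, X i (tnth t i)] /\
  leb n [set t : T n | forall i, X i (tnth t i)] = (\prod_(i < n) lambda (X i))%E.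
Proof.
elim: n X => [|n IH] X mX.
  have -> : [set t : T 0 | forall i : 'I_0, X i (tnth t i)] = setT.
    by apply/seteqP; split=> // t _ [].
  by split=> //; rewrite big_ord0 /= diracT.
have [mY Y] := IH (fun i => X (lift ord0 i)) (fun i => mX _).
set Z := [set t : T n.+1 | _].
have E : Z = (@uncons_pair n) @^-1` (X ord0 `*` [set t : T n | forall i, X (lift ord0 i) (tnth t i)]).
  apply/seteqP; split=> t.
    move=> Zt; split=> /=; first exact: Zt.
    by move=> i; have := Zt (lift ord0 i); rewrite [in tnth t _](tuple_eta t) tnthS.
  move=> [/= t0 tS] i; case: (unliftP ord0 i) => [j|] -> //.
  by rewrite [in tnth t _](tuple_eta t) tnthS.
have mZ : measurable Z.
  rewrite E -[X in measurable X]setTI; apply: measurable_uncons_pair => //.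
  exact: measurableX.
split=> //.
rewrite /= /leb_step /pushforward E -comp_preimage.
rewrite (_ : _ \o _ = id); last by apply/funext => p /=; rewrite cons_pairK.
by rewrite preimage_id product_measure1E // Y big_ord_recl.
Qed.

End NDimLebesgue.

(** * Bounds between [vol] and Lebesgue measure *)

Section VolumeAsMeasure.
Variable R : realType.
Notation T n := (n.-tuple (measurableTypeR R)).
Notation lambda := (@lebesgue_measure R).
Notation leb := (@leb R).

Definition row_of n (t : T n) : 'rV[R]_n := \row_i tnth t i.

Lemma EFin_prod n (f : 'I_n -> R) : (\prod_(i < n) (f i)%:E)%E = (\prod_(i < n) f i)%:E.
Proof. by rewrite (big_morph EFin (@EFinM R) (erefl _)). Qed.

Lemma leb_box n (a b : 'rV[R]_n) : (forall i, a 0 i <= b 0 i) ->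
  measurable (@row_of n @^-1` box a b) /\
  leb n (@row_of n @^-1` box a b) = (box_vol a b)%:E.
Proof.
move=> ab.
have [m e] := @leb_prod R n (fun i => `[a 0 i, b 0 i]%classic) (fun i => measurable_itv _).
rewrite (_ : _ @^-1` _ = [set t : T n | forall i, `[a 0 i, b 0 i]%classic (tnth t i)]); last first.
  by apply/seteqP; split=> t /= h i; have := h i; rewrite /row_of mxE in_itv.
split=> //; rewrite e /box_vol -EFin_prod; apply: eq_bigr => i _.
rewrite lebesgue_measure_itv /= lte_fin.
case: ltP => [|ba]; first by rewrite EFinB.
by congr EFin; apply/eqP; rewrite eq_sym subr_eq0 eq_le ab ba.
Qed.

(** Countable subadditivity over every competing cover. *)
Lemma leb_le_vol n (A : set 'rV[R]_n) : measurable (@row_of n @^-1` A) ->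
  (leb n (@row_of n @^-1` A) <= vol A)%E.
Proof.
move=> mA; apply: le_ereal_inf_tmp => _ [a [b [ab Aab ->]]].
rewrite (eq_eseriesr (g := fun k => leb n (@row_of n @^-1` box (a k) (b k)))); last first.
  by move=> k _; rewrite (leb_box (ab k)).2.
apply: measure_sigma_subadditive => //.
- by move=> k; exact: (leb_box (ab k)).1.
- by move=> t /Aab [k _ ?]; exists k.
Qed.

(** Floors describe half-open cells of side [s^-1]. They partition the space, so the measures of
    cells add up exactly, whereas closed boxes overlap. *)
Definition grid_eq n (s : R) (x y : 'rV[R]_n) :=
  forall i, Num.floor (s * x 0 i) = Num.floor (s * y 0 i).

Definition grid_hull n (s : R) (A : set 'rV[R]_n) := [set x | exists2 a, A a & grid_eq s x a].

(** Finite functions form a countable type, so cells can be enumerated through [pickle]. *)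
Let Z n := {ffun 'I_n -> int}.

Definition cell n (s : R) (f : Z n) : set 'rV[R]_n := [set x | forall i, Num.floor (s * x 0 i) = f i].

Lemma leb_cell n (s : R) (f : Z n) : 0 < s ->
  measurable (@row_of n @^-1` cell s f) /\ leb n (@row_of n @^-1` cell s f) = (s^-1 ^+ n)%:E.
Proof.
move=> s0.
pose I i := `[(f i)%:~R / s, (f i + 1)%:~R / s[%classic : set (measurableTypeR R).
have [m e] := @leb_prod R n I (fun i => measurable_itv _).
rewrite (_ : _ @^-1` _ = [set t : T n | forall i, I i (tnth t i)]); last first.
  have E i t : (Num.floor (s * row_of t 0 i) == f i) = (tnth t i \in `[(f i)%:~R / s, (f i + 1)%:~R / s[).
    by rewrite floor_eq in_itv /= /row_of mxE ler_pdivrMr// ltr_pdivlMr// mulrC.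
  apply/seteqP; split=> t /= h i; first by rewrite /I /= -E h.
  by apply/eqP; rewrite E; exact: h.
split=> //; rewrite e (eq_bigr (fun=> (s^-1)%:E)); last first.
  move=> i _; rewrite lebesgue_measure_itv /= lte_fin ltr_pM2r ?invr_gt0// ltr_int ltzD1 lexx.
  by rewrite -EFinB -mulrBl -intrB addrAC subrr add0r mul1r.
by rewrite EFin_prod prodr_const card_ord.
Qed.

(* In dimension 0 every box has volume 1, so the cover cannot be padded with
   boxes of volume 0. *)
Lemma vol_le_grid_hull n (s : R) (A : set 'rV[R]_n.+1) : 0 < s ->
  measurable (@row_of n.+1 @^-1` grid_hull s A) /\
  (vol A <= leb n.+1 (@row_of n.+1 @^-1` grid_hull s A))%E.
Proof.
move=> s0.
pose ok (f : Z n.+1) := `[< cell s f `&` A !=set0 >].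
(* Indices that code no cell, or a cell missing [A], contribute the empty set. *)
pose C k : set 'rV[R]_n.+1 := if (pickle_inv k : option (Z n.+1)) is Some f then
  (if ok f then cell s f else set0) else set0.
have CE : grid_hull s A = \bigcup_k C k.
  apply/seteqP; split=> x.
    move=> [a Aa xa]; exists (pickle ([ffun i => Num.floor (s * a 0 i)] : Z n.+1)); first by [].
    rewrite /C /ok pickleK_inv; case: asboolP; last first.
      by case; exists a; split=> // i; rewrite ffunE.
    by move=> _ i; rewrite ffunE; exact: xa.
  move=> [k _]; rewrite /C /ok; case: pickle_inv => // f; case: asboolP => // -[a [fa Aa]] fx.
  by exists a => // i; rewrite fa fx.
have mC k : measurable (@row_of n.+1 @^-1` C k).
  rewrite /C; case: pickle_inv => [f|]; last by rewrite preimage_set0.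
  by case: ifP => _; [exact: (leb_cell f s0).1 | rewrite preimage_set0].
have mG : measurable (@row_of n.+1 @^-1` grid_hull s A).
  by rewrite CE preimage_bigcup; exact: bigcup_measurable.
split=> //.
have tC : trivIset setT (fun k => @row_of n.+1 @^-1` C k).
  apply/trivIsetP => i j _ _ ij; apply/seteqP; split=> // t [/=]; rewrite /C.
  case Ei: (pickle_inv i) => [f|]//; case Ej: (pickle_inv j) => [g|]//.
  case: ifP => // _; case: ifP => // _ hf hg; move: ij.
  have fg : f = g by apply/ffunP => l; rewrite -hf -hg.
  move: (@pickle_invK (Z n.+1) i) (@pickle_invK (Z n.+1) j).
  by rewrite Ei Ej /= fg => <- <-; rewrite eqxx.
rewrite CE preimage_bigcup measure_semi_bigcup//; last first.
  by rewrite -preimage_bigcup -CE.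
(* The closures of these cells form a cover admissible for [vol], with the same total volume. *)
pose a k : 'rV[R]_n.+1 := if (pickle_inv k : option (Z n.+1)) is Some f then
  (if ok f then \row_i ((f i)%:~R / s) else 0) else 0.
pose b k : 'rV[R]_n.+1 := if (pickle_inv k : option (Z n.+1)) is Some f then
  (if ok f then \row_i ((f i + 1)%:~R / s) else 0) else 0.
have -> : (\sum_(0 <= k <oo) leb n.+1 (@row_of n.+1 @^-1` C k) =
           \sum_(0 <= k <oo) (box_vol (a k) (b k))%:E)%E.
  apply: eq_eseriesr => k _; rewrite /C /a /b.
  have v0 : @box_vol R n.+1 0 0 = 0.
    by rewrite /box_vol big_ord_recl mxE subrr mul0r.
  case: pickle_inv => [f|]; last by rewrite preimage_set0 measure0 v0.
  case: ifP => _; last by rewrite preimage_set0 measure0 v0.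
  rewrite (leb_cell f s0).2 /box_vol; congr EFin.
  rewrite (eq_bigr (fun=> s^-1)) ?prodr_const ?card_ord// => i _.
  by rewrite !mxE -mulrBl -intrB addrAC subrr add0r mul1r.
apply: ereal_inf_lbound; exists a, b; split=> // [k i|x Ax].
  rewrite /a /b; case: pickle_inv => [f|]//; case: ifP => // _.
  by rewrite !mxE ler_pM2r ?invr_gt0// ler_int lerDl.
have : grid_hull s A x by exists x.
rewrite CE => -[k _]; rewrite /C => Ckx; exists k => // i; rewrite /a /b.
move: Ckx; case: pickle_inv => [f|]//; case: ifP => // _ /(_ i) /eqP.
by rewrite floor_eq !mxE ler_pdivrMr// ler_pdivlMr// mulrC => /andP[-> /ltW].
Qed.

End VolumeAsMeasure.

(** * Agreement of [vol] and Lebesgue measure on compact sets *)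

Section VolumeOfCompact.
Variable R : realType.
Notation T n := (n.-tuple (measurableTypeR R)).
Notation lambda := (@lebesgue_measure R).
Notation leb := (@leb R).

Lemma ler_coord_norm n (v : 'rV[R]_n) i : `|v 0 i| <= `|v|.
Proof.
by rewrite [leRHS]/Num.norm /= mx_normrE; apply/bigmax_geP; right; exists (0, i).
Qed.

Lemma row_norm_le n (v : 'rV[R]_n) (e : R) : 0 <= e -> (forall i, `|v 0 i| <= e) -> `|v| <= e.
Proof.
move=> e0 h; rewrite [leLHS]/Num.norm /= mx_normrE; apply/bigmax_leP; split=> // -[j i] _ /=.
by rewrite ord1.
Qed.

Lemma lipschitz_continuous (V W : normedModType R) (f : V -> W) (L : R) :
  (forall x y, `|f x - f y| <= L * `|x - y|) -> continuous f.
Proof.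
move=> fL x; apply/cvgrPdist_lt => e e0.
pose L' := Num.max L 1.
have L'0 : 0 < L' by rewrite lt_max ltr01 orbT.
near=> y.
apply: le_lt_trans (fL _ _) _.
apply: (@le_lt_trans _ _ (L' * `|x - y|)); first by rewrite ler_wpM2r// le_max lexx.
rewrite mulrC -ltr_pdivlMr//.
by near: y; apply: cvgr_dist_lt; rewrite ?divr_gt0.
Unshelve. all: by end_near. Qed.

Lemma closedE_norm n (A : set 'rV[R]_n) :
  closed A -> forall x, (forall e : R, 0 < e -> exists2 a, A a & `|x - a| < e) -> A x.
Proof.
move=> cA x h; apply: cA => B /nbhs_normP [e /= e0 eB].
by have [a Aa xa] := h e e0; exists a; split=> //; exact: eB.
Qed.

Lemma compact_norm_le n (A : set 'rV[R]_n) : compact A -> exists2 M : R, 0 < M & forall x, A x -> `|x| <= M.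
Proof.
move=> /compact_bounded [M [_ hM]]; exists (Num.max (M + 1) 1).
  by rewrite lt_max ltr01 orbT.
by move=> x Ax; apply: hM => //; rewrite lt_max ltrDl ltr01.
Qed.

Lemma grid_eq_dist n (s : R) (x y : 'rV[R]_n) : 0 < s -> grid_eq s x y -> `|x - y| <= s^-1.
Proof.
move=> s0 xy; apply: row_norm_le; first by rewrite invr_ge0 ltW.
move=> i; rewrite !mxE; have := floor_itv (s * x 0 i); have := floor_itv (s * y 0 i).
rewrite (xy i) intrD => /andP[y1 y2] /andP[x1 x2].
rewrite -(ler_pM2l s0) divff ?gt_eqF// -{1}(gtr0_norm s0) -normrM mulrBr ler_norml; lra.
Qed.

(** For an integer [m], [m <= a] amounts to [2 * m <= 2 * a], so doubling [s] refines the grid and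
    the hulls at scales [2 ^+ k] decrease. *)
Lemma grid_eq_half n (s : R) (x y : 'rV[R]_n) : grid_eq (2 * s) x y -> grid_eq s x y.
Proof.
move=> xy i; have := xy i; set a := _ * _; set b := _ * _ => ab.
have E (m : int) : (m <= Num.floor (s * x 0 i)) = (m <= Num.floor (s * y 0 i)).
  rewrite !floor_ge_int -(@ler_pM2l _ 2 _ m%:~R (s * x 0 i))// -(@ler_pM2l _ 2 _ m%:~R (s * y 0 i))// !mulrA.
  have -> : 2 * m%:~R = (2 * m)%:~R :> R by rewrite intrM.
  by rewrite -!floor_ge_int -/a -/b ab.
by apply/eqP; rewrite eq_le -E lexx E lexx.
Qed.

(** The grid hulls of a closed set decrease to it, and continuity from above carries the bound of
    [vol A] by their measures to the limit. *)
Lemma compact_vol n (A : set 'rV[R]_n.+1) : compact A ->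
  [/\ measurable (@row_of R n.+1 @^-1` A),
      vol A = leb n.+1 (@row_of R n.+1 @^-1` A) & vol A \is a fin_num].
Proof.
move=> coA.
have clA : closed A by exact: compact_closed.
pose s k : R := 2 ^+ k.
have s0 k : 0 < s k by rewrite exprn_gt0.
pose F k := @row_of R n.+1 @^-1` grid_hull (s k) A.
have AE : @row_of R n.+1 @^-1` A = \bigcap_k F k.
  apply/seteqP; split=> t At; first by move=> k _; exists (row_of t).
  apply: (closedE_norm clA) => e e0.
  have [k ke] : exists k, (s k)^-1 < e.
    have [k _ hk] := near_infty_natSinv_expn_lt (PosNum e0).
    exists k; have := hk k (leqnn k); rewrite /= /s div1r; apply: le_lt_trans.
    by rewrite lef_pV2 ?posrE// lexx.
  have [a Aa /(grid_eq_dist (s0 k)) ta] := At k I.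
  by exists a => //; exact: le_lt_trans ta ke.
have mF k : measurable (F k) by exact: (vol_le_grid_hull A (s0 k)).1.
have mA : measurable (@row_of R n.+1 @^-1` A) by rewrite AE; exact: bigcapT_measurable.
(* Continuity from above needs one hull of finite measure. At [k = 0] the cells have side 1, hence
   the bound [M + 1]. *)
have F0 : (leb n.+1 (F 0%N) < +oo)%E.
  have [M M0 hM] := compact_norm_le coA.
  pose b : 'rV[R]_n.+1 := const_mx (M + 1).
  have ab i : (- b) 0 i <= b 0 i by rewrite !mxE; lra.
  have [mb lb] := leb_box ab.
  apply: (@le_lt_trans _ _ (leb n.+1 (@row_of R n.+1 @^-1` box (- b) b))); last by rewrite lb ltry.
  apply: le_measure; rewrite ?inE// => t [a /hM Ma /(grid_eq_dist (s0 0%N)) ta] i.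
  have := ler_coord_norm (row_of t - a) i; have := ler_coord_norm a i.
  rewrite /s expr0 invr1 in ta; rewrite !mxE -ler_norml => h1 h2.
  rewrite -(subrK (a 0 i) (tnth _ _)) (le_trans (ler_normD _ _))//.
  by rewrite addrC lerD//; [exact: le_trans h1 _ | exact: le_trans h2 _].
have cF : (leb n.+1 \o F) k @[k --> \oo] --> leb n.+1 (\bigcap_k F k).
  apply: nonincreasing_cvg_mu => //; first by rewrite -AE.
  apply/nonincreasing_seqP => k; apply/subsetPset => t [a Aa h]; exists a => //.
  by apply: grid_eq_half; rewrite /s exprS in h.
have e : vol A = leb n.+1 (@row_of R n.+1 @^-1` A).
  apply/eqP; rewrite eq_le leb_le_vol// andbT AE.
  by apply: cvge_to_ge cF _; near=> k; exact: (vol_le_grid_hull A (s0 k)).2.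
split=> //; rewrite e ge0_fin_numE//.
by rewrite AE; apply: le_lt_trans F0; apply: le_measure; rewrite ?inE -?AE// AE => t; apply.
Unshelve. all: by end_near. Qed.

End VolumeOfCompact.

(** * Invariance of volume and comparison by chords *)

Section VolumeInvariance.
Variable R : realType.
Notation T n := (n.-tuple (measurableTypeR R)).
Notation lambda := (@lebesgue_measure R).
Notation leb := (@leb R).

Lemma vol_mono n (A B : set 'rV[R]_n) : A `<=` B -> (vol A <= vol B)%E.
Proof.
move=> AB; apply: le_ereal_inf => _ [a [b [ab Bab ->]]].
by exists a, b; split=> //; exact: subset_trans Bab.
Qed.

(** Translations, dilations and permutations of coordinates send boxes into boxes, so they act
    directly on covers of arbitrary sets. *)
Lemma vol_image_le n (f : 'rV[R]_n -> 'rV[R]_n) (c : R) (A : set 'rV[R]_n) : 0 < c ->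
  (forall a b : 'rV[R]_n, (forall i, a 0 i <= b 0 i) -> exists a' b' : 'rV[R]_n,
     [/\ forall i, a' 0 i <= b' 0 i, f @` box a b `<=` box a' b' &
         box_vol a' b' = c * box_vol a b]) ->
  (vol (f @` A) <= c%:E * vol A)%E.
Proof.
move=> c0 hf; rewrite -lee_pdivrMl//.
apply: le_ereal_inf_tmp => _ [a [b [ab Aab ->]]]; rewrite lee_pdivrMl//.
pose g k := cid (hf _ _ (ab k)); pose h k := cid (projT2 (g k)).
pose a' k := projT1 (g k); pose b' k := projT1 (h k).
have hab k : [/\ forall i, a' k 0 i <= b' k 0 i, f @` box (a k) (b k) `<=` box (a' k) (b' k) &
         box_vol (a' k) (b' k) = c * box_vol (a k) (b k)] := projT2 (h k).
apply: ereal_inf_lbound; exists a', b'; split=> [k i|_ [x Ax <-]|].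
- by have [] := hab k.
- have [k _ xk] := Aab _ Ax; exists k => //; have [_ + _] := hab k.
  by apply; exists x.
- rewrite -nneseriesZl; last first.
    move=> k _; rewrite lee_fin; apply: prodr_ge0 => i _; by rewrite subr_ge0.
  by apply: eq_eseriesr => k _; have [_ _ ->] := hab k.
Qed.

Lemma vol_image_eq n (f g : 'rV[R]_n -> 'rV[R]_n) (c : R) (A : set 'rV[R]_n) : 0 < c ->
  cancel f g ->
  (forall B, (vol (f @` B) <= c%:E * vol B)%E) ->
  (forall B, (vol (g @` B) <= (c^-1)%:E * vol B)%E) ->
  vol (f @` A) = (c%:E * vol A)%E.
Proof.
move=> c0 fK hf hg; apply/eqP; rewrite eq_le hf/= -lee_pdivlMl//.
by have := hg (f @` A); rewrite image_comp (_ : g \o f = id) ?image_id//; apply/funext.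
Qed.

Lemma vol_translate n (w : 'rV[R]_n) (A : set 'rV[R]_n) :
  vol ((fun x => x + w) @` A) = vol A.
Proof.
have h (v : 'rV[R]_n) (B : set 'rV[R]_n) : (vol ((fun x => x + v)%R @` B) <= 1%:E * vol B)%E.
  apply: vol_image_le => // a b ab; exists (a + v), (b + v); split.
  - by move=> i; rewrite !mxE lerD2r.
  - by move=> _ [x xab <-] i; rewrite !mxE !lerD2r; exact: xab.
  - by rewrite mul1r; apply: eq_bigr => i _; rewrite !mxE; ring.
rewrite (@vol_image_eq _ _ (fun x => x - w) 1)// ?mul1e//; first exact: addrK.
by rewrite invr1; exact: h.
Qed.

Lemma vol_scale n (c : R) (A : set 'rV[R]_n) : 0 < c ->
  vol (( *:%R c) @` A) = ((c ^+ n)%:E * vol A)%E.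
Proof.
move=> c0.
have h (d : R) B : 0 < d -> (vol (( *:%R d) @` B : set 'rV[R]_n) <= (d ^+ n)%:E * vol B)%E.
  move=> d0; apply: vol_image_le; first exact: exprn_gt0.
  move=> a b ab; exists (d *: a), (d *: b); split.
  - by move=> i; rewrite !mxE ler_pM2l.
  - by move=> _ [x xab <-] i; rewrite !mxE !ler_pM2l//; exact: xab.
  - rewrite /box_vol (eq_bigr (fun i => d * (b 0 i - a 0 i))) => [|i _].
      by rewrite big_split /= prodr_const card_ord.
    by rewrite !mxE mulrBr.
apply: (@vol_image_eq _ _ ( *:%R c^-1)) => [|x|B|B]; first exact: exprn_gt0.
- by rewrite scalerA mulVf ?gt_eqF// scale1r.
- exact: h.
- by rewrite -exprVn; apply: h; rewrite invr_gt0.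
Qed.

Lemma vol_perm n (s : 'S_n) (A : set 'rV[R]_n) : vol (col_perm s @` A) = vol A.
Proof.
have h (p : 'S_n) B : (vol (col_perm p @` B : set 'rV[R]_n) <= 1%:E * vol B)%E.
  apply: vol_image_le => // a b ab; exists (col_perm p a), (col_perm p b); split.
  - by move=> i; rewrite !mxE.
  - by move=> _ [x xab <-] i; rewrite !mxE; exact: xab.
  - rewrite mul1r /box_vol [RHS](reindex_inj (@perm_inj _ p)) /=.
    by apply: eq_bigr => i _; rewrite !mxE.
rewrite (@vol_image_eq _ _ (col_perm s^-1) 1)// ?mul1e// => [x|B].
  by rewrite -col_permM mulVg col_perm1.
by rewrite invr1; exact: h.
Qed.

Lemma row_of_cons n s (y : T n) i : row_of (cons_pair (s, y)) 0 (lift ord0 i) = row_of y 0 i.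
Proof. by rewrite !mxE tnthS. Qed.

Lemma row_of_cons0 n s (y : T n) : row_of (cons_pair (s, y)) 0 ord0 = s.
Proof. by rewrite !mxE. Qed.

Definition tuple_of_row n (x : 'rV[R]_n) : T n := [tuple x 0 i | i < n].

Lemma tuple_of_rowK n : cancel (@tuple_of_row n) (@row_of R n).
Proof. by move=> x; apply/rowP => i; rewrite mxE tnth_mktuple. Qed.

Lemma row_ofK n : cancel (@row_of R n) (@tuple_of_row n).
Proof. by move=> t; apply: eq_from_tnth => i; rewrite tnth_mktuple mxE. Qed.

Lemma compact_slice n (A : set 'rV[R]_n.+1) s : compact A ->
  compact [set y : 'rV[R]_n | A (row_of (cons_pair (s, tuple_of_row y)))].
Proof.
move=> coA; apply: bounded_closed_compact.
  have [M M0 hM] := compact_norm_le coA.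
  exists M; split; first exact: num_real.
  move=> M' MM' y /= /hM Ay; apply: row_norm_le; first by rewrite ltW// (lt_trans M0).
  move=> i; apply: le_trans (ltW MM'); apply: le_trans Ay.
  by apply: le_trans (ler_coord_norm _ (lift ord0 i)); rewrite row_of_cons tuple_of_rowK.
apply: (@closed_comp _ _ (fun y : 'rV[R]_n => row_of (cons_pair (s, tuple_of_row y)))); last exact: compact_closed.
move=> y _; apply: (@lipschitz_continuous R _ _ _ 1) => x z.
rewrite mul1r; apply: row_norm_le => // i; rewrite !mxE.
case: (unliftP ord0 i) => [j|] ->.
  by rewrite !tnthS !tnth_mktuple; have := ler_coord_norm (x - z) j; rewrite !mxE.
by rewrite subrr normr0.
Qed.

(** [leb] inherits translation invariance from [vol] on compact sets; in dimension 0 there is a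
    single tuple. *)
Lemma leb_translate_slice n (A : set 'rV[R]_n.+1) s (v : 'rV[R]_n) : compact A ->
  leb n [set y | A (row_of (cons_pair (s, tuple_of_row (row_of y - v))))] =
  leb n [set y | A (row_of (cons_pair (s, y)))].
Proof.
case: n A v => [|n] A v coA.
  congr (leb 0 _); apply/seteqP; split=> y /=; by rewrite [tuple_of_row _]tuple0 [y]tuple0.
pose B := [set y : 'rV[R]_n.+1 | A (row_of (cons_pair (s, tuple_of_row y)))].
have coB : compact B by exact: compact_slice.
have coB' : compact ((fun x => x + v) @` B).
  apply: continuous_compact => //; apply: continuous_subspaceT.
  apply: (@lipschitz_continuous R _ _ _ 1) => x y.
  by rewrite mul1r opprD addrACA subrr addr0.
have [_ e _] := compact_vol coB; have [_ e' _] := compact_vol coB'.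
rewrite (_ : [set y | A (row_of (cons_pair (s, y)))] = @row_of R n.+1 @^-1` B); last first.
  by apply/seteqP; split=> t; rewrite /B /= row_ofK.
rewrite -e -(vol_translate v) e'; congr (leb n.+1 _).
apply/seteqP; split=> t /=.
  by move=> h; exists (row_of t - v) => //; rewrite subrK.
by move=> [y By yt]; move: By; rewrite /B /= -yt addrK.
Qed.

(* The slice at x_0 = s is translated by s w. *)
Lemma vol_shear n (w : 'rV[R]_n.+1) (A : set 'rV[R]_n.+1) : w 0 0 = 0 -> compact A ->
  compact ((fun x => x + x 0 0 *: w) @` A) /\ vol ((fun x => x + x 0 0 *: w) @` A) = vol A.
Proof.
move=> w0 coA; set f := fun x => _.
have coA' : compact (f @` A).
  apply: continuous_compact => //; apply: continuous_subspaceT.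
  apply: (@lipschitz_continuous R _ _ _ (1 + `|w|)) => x y.
  rewrite /f opprD addrACA -scalerBl (le_trans (ler_normD _ _))// mulrDl mul1r lerD2l.
  by rewrite normrZ mulrC ler_wpM2l//; have := ler_coord_norm (x - y) 0; rewrite !mxE.
have [mA -> _] := compact_vol coA; have [mA' -> _] := compact_vol coA'.
split=> //; rewrite !leb_sliceE//; apply: eq_integral => s _.
pose v : 'rV[R]_n := \row_i (s * w 0 (lift ord0 i)).
rewrite -(leb_translate_slice s v coA); congr (leb n _).
have fcons y : f (row_of (cons_pair (s, tuple_of_row (row_of y - v)))) = row_of (cons_pair (s, y)).
  apply/rowP => i; rewrite /f row_of_cons0 !mxE; case: (unliftP ord0 i) => [j|] ->.
    by rewrite !tnthS tnth_mktuple !mxE subrK.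
  by rewrite w0 mulr0 addr0.
apply/seteqP; split=> y /=; last by move=> Ay; rewrite -fcons; eexists; first exact: Ay.
move=> [x Ax]; rewrite -fcons => fx; rewrite (_ : row_of _ = x)//.
have fK z : f z - (f z) 0 0 *: w = z.
  by rewrite /f !mxE w0 mulr0 addr0 addrK.
by rewrite -[LHS]fK -fx fK.
Qed.

(** A chord is recorded by its parameters, so its length is in units of the length of [u]; chords
    are compared only along a common [u]. *)
Definition chord n (A : set 'rV[R]_n) (u x : 'rV[R]_n) : set (measurableTypeR R) := [set t | A (x + t *: u)].

Lemma measurable_chord n (A : set 'rV[R]_n) u x : compact A -> measurable (chord A u x).
Proof.
move=> /compact_closed cA; apply: closed_measurable.
apply: (@closed_comp _ _ (fun t : R => x + t *: u)); last exact: cA.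
move=> y _; apply: (@lipschitz_continuous R R _ _ `|u|) => s t.
by rewrite opprD addrACA subrr add0r -scalerBl normrZ mulrC.
Qed.

(** Along the first basis vector chords are fibers, and integrating over the other coordinates gives
    the claim. The two sets on the right stand for the two candidate polytopes. *)
Lemma cavalieri0 n (u : 'rV[R]_n.+1) (A B C : set 'rV[R]_n.+1) : u = delta_mx 0 0 ->
  compact A -> compact B -> compact C ->
  (forall x, (2%:E * lambda (chord A u x) <= lambda (chord B u x) + lambda (chord C u x))%E) ->
  (2%:E * vol A <= vol B + vol C)%E.
Proof.
move=> uE coA coB coC h.
have [mA -> _] := compact_vol coA; have [mB -> _] := compact_vol coB; have [mC -> _] := compact_vol coC.
have E (D : set 'rV[R]_n.+1) : measurable (@row_of R n.+1 @^-1` D) ->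
    leb n.+1 (@row_of R n.+1 @^-1` D) =
    (\int[leb n]_y (lambda \o (fun y => chord D u (row_of (cons_pair (0%R, y))))) y)%E /\
    measurable_fun setT (lambda \o (fun y => chord D u (row_of (cons_pair (0%R, y))))).
  move=> mD; have e (y : T n) : [set s | (@row_of R n.+1 @^-1` D) (cons_pair (s, y))] =
      chord D u (row_of (cons_pair (0%R, y))).
    apply/seteqP; split=> s; rewrite /chord /=; congr D; apply/rowP => i; rewrite uE !mxE;
      case: (unliftP ord0 i) => [j|] ->; rewrite ?tnthS /= ?mulr0 ?addr0 ?mulr1 ?add0r//.
  split; first by rewrite leb_fiberE//; apply: eq_integral => y _ /=; rewrite e.
  have := measurable_fiber mD; congr (measurable_fun _ _); apply/funext => y /=; by rewrite e.
have [-> mA1] := E A mA; have [-> mB1] := E B mB; have [-> mC1] := E C mC.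
rewrite -ge0_integralZl// -?ge0_integralD//.
apply: ge0_le_integral => //.
- by move=> x _; rewrite mule_ge0.
- exact: measurable_funeM.
- exact: emeasurable_funD.
- by move=> x _; exact: h.
Qed.

(** Reduction to the first basis vector by maps that preserve volume and the parameters of
    chords. *)
Lemma cavalieri n (j : 'I_n.+1) (u : 'rV[R]_n.+1) (A B C : set 'rV[R]_n.+1) : u 0 j = 1 ->
  compact A -> compact B -> compact C ->
  (forall x, (2%:E * lambda (chord A u x) <= lambda (chord B u x) + lambda (chord C u x))%E) ->
  (2%:E * vol A <= vol B + vol C)%E.
Proof.
wlog -> : j u A B C / j = 0.
  move=> W uj coA coB coC h.
  pose p := tperm 0 j.
  have pK : involutive (@col_perm R 1 n.+1 p).
    by move=> x; rewrite -col_permM tperm2 col_perm1.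
  have co (D : set 'rV[R]_n.+1) : compact D -> compact (col_perm p @` D).
    move=> coD; apply: continuous_compact => //; apply: continuous_subspaceT.
    apply: (@lipschitz_continuous R _ _ _ 1) => x y; rewrite mul1r.
    apply: row_norm_le => // i; rewrite !mxE.
    by have := ler_coord_norm (x - y) (p i); rewrite !mxE.
  rewrite -(vol_perm p A) -(vol_perm p B) -(vol_perm p C).
  apply: (W 0 (col_perm p u)) => //; [by rewrite mxE tpermL| exact: co..|].
  have ch (D : set 'rV[R]_n.+1) x : chord (col_perm p @` D) (col_perm p u) x = chord D u (col_perm p x).
    apply/seteqP; split=> t; rewrite /chord /=.
      move=> [y Dy e]; rewrite (_ : _ + _ = y)//; rewrite -[y]pK e.
      by apply/rowP => i; rewrite !mxE tpermK.
    by move=> Dy; eexists; first exact: Dy; apply/rowP => i; rewrite !mxE tpermK.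
  by move=> x; rewrite !ch.
move=> u0 coA coB coC h.
(* As [u 0 0 = 1], the shear by [w] sends [u] to the first basis vector. *)
pose w : 'rV[R]_n.+1 := delta_mx 0 0 - u.
have w0 : w 0 0 = 0 by rewrite !mxE u0 /= subrr.
have [coA' <-] := vol_shear w0 coA; have [coB' <-] := vol_shear w0 coB; have [coC' <-] := vol_shear w0 coC.
apply: (@cavalieri0 _ (delta_mx 0 0)) => //.
have ch (D : set 'rV[R]_n.+1) x : chord ((fun x : 'rV[R]_n.+1 => x + x 0 0 *: w) @` D) (delta_mx 0 0) x = chord D u (x - x 0 0 *: w).
  apply/seteqP; split=> t; rewrite /chord /=.
    move=> [y Dy e]; suff -> : x - x 0 0 *: w + t *: u = y by [].
    have e0 : y 0 0 = x 0 0 + t.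
      by have /rowP/(_ 0) := e; rewrite !mxE u0 /= subrr mulr0 addr0 mulr1.
    apply/rowP => i; have /rowP/(_ i) := e; rewrite !mxE e0 /= => h1.
    have -> : y 0 i = x 0 i + t * (i == 0)%:R - (x 0 0 + t) * ((i == 0)%:R - u 0 i) by rewrite -h1; ring.
    by ring.
  move=> Dy; eexists; first exact: Dy; apply/rowP => i; rewrite !mxE u0 /=; ring.
by move=> x; rewrite !ch.
Qed.

End VolumeInvariance.

(** * Convex hulls of finitely many points *)

Section Polytopes.
Variable R : realType.

Lemma convex_comb n (A : set 'rV[R]_n) k (l : 'I_k -> R) (w : 'I_k -> 'rV[R]_n) :
  convex_set A -> (forall i, 0 <= l i) -> \sum_(i < k) l i = 1 ->
  (forall i, A (w i)) -> A (\sum_(i < k) l i *: w i).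
Proof.
move=> cA; elim: k l w => [|k IH] l w l0 l1 Aw.
  by move: l1; rewrite big_ord0 => /esym/eqP; rewrite oner_eq0.
rewrite big_ord_recl; rewrite big_ord_recl in l1.
set r := \sum_(i < k) _ in l1.
have r0 : 0 <= r by apply: sumr_ge0.
(* Tail weights with sum 0 cannot be renormalized, but then they all vanish. *)
have [rz|rn0] := eqVneq r 0.
  rewrite big1 ?addr0 => [|i _]; first by rewrite -[l ord0]addr0 -rz l1 scale1r.
  have /eqP := rz; rewrite psumr_eq0// => /allP/(_ i (mem_index_enum _)) /=.
  by move=> /eqP ->; rewrite scale0r.
have -> : \sum_(i < k) l (lift ord0 i) *: w (lift ord0 i) =
    (1 - l ord0) *: \sum_(i < k) (l (lift ord0 i) / r) *: w (lift ord0 i).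
  rewrite scaler_sumr; apply: eq_bigr => i _; rewrite scalerA -l1 addrAC subrr add0r.
  by rewrite mulrC divfK.
apply: cA => //; last by rewrite -l1 lerDl.
apply: IH => // [i|]; first by rewrite divr_ge0.
by rewrite -mulr_suml divff.
Qed.

Lemma conv_hull_convex n k (v : 'I_k -> 'rV[R]_n) : convex_set (conv_hull v).
Proof.
move=> x y t [l [l0 [l1 ->]]] [l' [l'0 [l'1 ->]]] t0 t1.
exists (fun i => t * l i + (1 - t) * l' i); split; last split.
- by move=> i; rewrite addr_ge0// mulr_ge0// subr_ge0.
- by rewrite big_split /= -!mulr_sumr l1 l'1; ring.
- rewrite !scaler_sumr -big_split /=; apply: eq_bigr => i _.
  by rewrite !scalerA -scalerDl.
Qed.

Lemma conv_hull_vertex n k (v : 'I_k -> 'rV[R]_n) i : conv_hull v (v i).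
Proof.
exists (fun j => (j == i)%:R); split; last split.
- by move=> j; rewrite ler0n.
- by rewrite (bigD1 i) //= eqxx big1 ?addr0// => j /negPf ->.
- by rewrite (bigD1 i) //= eqxx scale1r big1 ?addr0// => j /negPf ->; rewrite scale0r.
Qed.

Lemma conv_hull_sub n k (v : 'I_k -> 'rV[R]_n) (A : set 'rV[R]_n) :
  convex_set A -> (forall i, A (v i)) -> conv_hull v `<=` A.
Proof. by move=> cA Av _ [l [l0 [l1 ->]]]; exact: convex_comb. Qed.

Lemma conv_hull_sym n k (v : 'I_k -> 'rV[R]_n) :
  (forall i, exists j, v j = - v i) -> sym_about 0 (conv_hull v).
Proof.
move=> h x [l [l0 [l1 ->]]]; rewrite scaler0 sub0r -sumrN.
under eq_bigr do rewrite -scalerN.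
apply: convex_comb => //; first exact: conv_hull_convex.
by move=> i; have [j <-] := h i; exact: conv_hull_vertex.
Qed.

(** The hull is a linear image of the standard simplex. *)
Lemma conv_hull_compact n k (v : 'I_k -> 'rV[R]_n) : compact (conv_hull v).
Proof.
pose S := [set l : 'rV[R]_k | (forall i, 0 <= l 0 i) /\ \sum_i l 0 i = 1].
have -> : conv_hull v = (fun l : 'rV[R]_k => \sum_i l 0 i *: v i) @` S.
  apply/seteqP; split=> x.
    move=> [l [l0 [l1 ->]]]; exists (\row_i l i).
      by split=> [i|]; rewrite ?mxE// -l1; apply: eq_bigr => i _; rewrite mxE.
    by apply: eq_bigr => i _; rewrite mxE.
  by move=> [l [l0 l1] <-]; exists (fun i => l 0 i).
apply: continuous_compact.
  apply: continuous_subspaceT; apply: (@lipschitz_continuous R _ _ _ (\sum_i `|v i|)) => x y.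
  rewrite -sumrB (le_trans (ler_norm_sum _ _ _))// mulr_suml ler_sum// => i _.
  by rewrite -scalerBl normrZ mulrC ler_wpM2l//; have := ler_coord_norm (x - y) i; rewrite !mxE.
apply: bounded_closed_compact.
  exists 1; split; first exact: num_real.
  move=> M M1 l [l0 l1]; apply: (le_trans _ (ltW M1)); apply: row_norm_le => // i.
  by rewrite ger0_norm// -l1 (bigD1 i)//= lerDl sumr_ge0.
have -> : S = (\bigcap_(i in [set: 'I_k]) ((fun l : 'rV[R]_k => l 0 i) @^-1` [set r | 0 <= r])) `&`
    (fun l : 'rV[R]_k => \sum_i l 0 i) @^-1` [set 1].
  by apply/seteqP; split=> l [h1 h2]; split=> // i; [move=> _; exact: h1 | exact: h1].
apply: closedI.
  apply: closed_bigI => i _; apply: closed_comp; last exact: closed_ge.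
  move=> x _; apply: (@lipschitz_continuous R _ _ _ 1) => {}x y.
  by rewrite mul1r; have := ler_coord_norm (x - y) i; rewrite !mxE.
apply: closed_comp; last exact: closed_eq.
move=> x _; apply: (@lipschitz_continuous R _ _ _ k%:R) => {}x y.
rewrite -sumrB (le_trans (ler_norm_sum _ _ _))//.
apply: (@le_trans _ _ (\sum_(i < k) `|x - y|)); last by rewrite sumr_const card_ord mulr_natl.
by apply: ler_sum => i _; have := ler_coord_norm (x - y) i; rewrite !mxE.
Qed.

(** As [l i < 1], the relation can be solved for [v i], which becomes a convex combination of the
    other points. *)
Lemma conv_hull_drop n k (v : 'I_k.+1 -> 'rV[R]_n) i (l : 'I_k.+1 -> R) :
  (forall j, 0 <= l j) -> \sum_j l j = 1 -> v i = \sum_j l j *: v j -> l i < 1 ->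
  conv_hull v = conv_hull (v \o lift i).
Proof.
move=> l0 l1 vi li; apply/seteqP; split; last first.
  by apply: conv_hull_sub => [|j]; [exact: conv_hull_convex | exact: conv_hull_vertex].
apply: conv_hull_sub => [|j]; first exact: conv_hull_convex.
case: (unliftP i j) => [j'|] ->; first exact: (conv_hull_vertex (v \o lift i)).
have d0 : 0 < 1 - l i by rewrite subr_gt0.
exists (fun j => l (lift i j) / (1 - l i)); split; last split.
- by move=> j'; rewrite divr_ge0// ltW.
- rewrite -mulr_suml -{1}l1 (bigD1_ord i)//= addrAC subrr add0r divff//.
  by move: d0; rewrite -{1}l1 (bigD1_ord i)//= addrAC subrr add0r => /gt_eqF ->.
- apply: (scalerI (lt0r_neq0 d0)); rewrite scaler_sumr scalerBl scale1r {1}vi.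
  rewrite (bigD1_ord i)//= addrAC subrr add0r; apply: eq_bigr => j' _.
  by rewrite scalerA mulrC divfK// gt_eqF.
Qed.

(* Write -v_i as a convex combination with coefficients A_ij. Minimality of the
   vertex set forces A^2 = 1, so the stochastic matrix A is a permutation. *)
Lemma symmetric_vertices n m (P : set 'rV[R]_n) : polytope_le m P -> sym_about 0 P ->
  exists k (v : 'I_k -> 'rV[R]_n), [/\ (k <= m)%N, P = conv_hull v & forall i, exists j, v j = - v i].
Proof.
move=> [k0 [v0 [k0m P0]]] sP.
pose Q k := `[< exists v : 'I_k -> 'rV[R]_n, P = conv_hull v >].
have exQ : exists k, Q k by exists k0; apply/asboolP; exists v0.
case: (ex_minnP exQ) => k /asboolP [v Pv] kmin.
exists k, v; split=> //.
  by apply: leq_trans k0m; apply: kmin; apply/asboolP; exists v0.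
(* A coefficient below 1 would allow [v i] to be dropped, against the minimality of [k]. *)
have vmin i (l : 'I_k -> R) : (forall j, 0 <= l j) -> \sum_j l j = 1 ->
    v i = \sum_j l j *: v j -> 1 <= l i.
  case: k v kmin Pv i l => [|k] v kmin Pv i l; first by case: i.
  move=> l0 l1 vi; rewrite leNgt; apply/negP => li.
  suff : (k < k)%N by rewrite ltnn.
  apply: kmin; apply/asboolP; exists (v \o lift i).
  by rewrite -(conv_hull_drop l0 l1 vi li).
have hA i : exists l : 'I_k -> R, (forall j, 0 <= l j) /\ \sum_j l j = 1 /\ - v i = \sum_j l j *: v j.
  by have := sP (v i); rewrite scaler0 sub0r Pv; apply; exact: conv_hull_vertex.
pose A i := projT1 (cid (hA i)).
have A0 i j : 0 <= A i j by exact: (projT2 (cid (hA i))).1.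
have A1 i : \sum_j A i j = 1 by exact: (projT2 (cid (hA i))).2.1.
have Av i : - v i = \sum_j A i j *: v j by exact: (projT2 (cid (hA i))).2.2.
(* [B] is the square of [A]; negating twice, it represents [v i] itself. *)
pose B i l := \sum_j A i j * A j l.
have B0 i l : 0 <= B i l by apply: sumr_ge0 => j _; exact: mulr_ge0.
have B1 i : \sum_l B i l = 1.
  rewrite exchange_big /= -[RHS](A1 i); apply: eq_bigr => j _.
  by rewrite -mulr_sumr A1 mulr1.
have Bv i : v i = \sum_l B i l *: v l.
  rewrite -[LHS]opprK Av -sumrN.
  under eq_bigr => j _ do rewrite -scalerN Av scaler_sumr.
  rewrite exchange_big /=; apply: eq_bigr => l _; rewrite scaler_suml.
  by apply: eq_bigr => j _; rewrite scalerA.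
have Bii i : B i i = 1.
  by apply/eqP; rewrite eq_le vmin// andbT -(B1 i) [leRHS](bigD1 i)//= lerDl sumr_ge0.
move=> i.
have [j Aij] : exists j, 0 < A i j.
  apply/existsP; rewrite -[X in is_true X]negbK negb_exists; apply/negP => /forallP h.
  have := A1 i; rewrite big1 => [/esym/eqP|j _]; first by rewrite oner_eq0.
  by apply/eqP; rewrite eq_le A0 andbT leNgt.
exists j; apply/eqP; rewrite -eqr_oppLR; apply/eqP.
(* [B i i = 1] is the mean of the numbers [A j i <= 1] with weights [A i j], so [A j i = 1] wherever
   the weight is positive. Row [j] is then concentrated at [i]. *)
have Aji : A j i = 1.
  have : \sum_j A i j * (1 - A j i) = 0.
    under eq_bigr do rewrite mulrBr mulr1.
    by rewrite sumrB A1 -/(B i i) Bii subrr.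
  have Ale1 a b : A a b <= 1 by rewrite -(A1 a) (bigD1 b)//= lerDl sumr_ge0.
  move=> /eqP; rewrite psumr_eq0; last by move=> a _; rewrite mulr_ge0// subr_ge0.
  move=> /allP/(_ j (mem_index_enum _)) /=.
  by rewrite mulf_eq0 gt_eqF//= subr_eq0 eq_sym => /eqP.
rewrite Av (bigD1 i)//= Aji scale1r big1 ?addr0// => l li.
have := A1 j; rewrite (bigD1 i)//= Aji -[RHS]addr0 => /addrI /eqP.
by rewrite psumr_eq0// => /allP/(_ l (mem_index_enum _)); rewrite li => /eqP ->; rewrite scale0r.
Qed.

End Polytopes.

(** * Euclidean norm and balls *)

Section Euclid.
Variables (R : realType) (n : nat).
Implicit Types x y u : 'rV[R]_n.

Definition dot x y : R := \sum_i x 0 i * y 0 i.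

Lemma dotC x y : dot x y = dot y x.
Proof. by apply: eq_bigr => i _; rewrite mulrC. Qed.

Lemma dotDl x y u : dot (x + y) u = dot x u + dot y u.
Proof. by rewrite -big_split; apply: eq_bigr => i _; rewrite mxE mulrDl. Qed.

Lemma dotZl c x u : dot (c *: x) u = c * dot x u.
Proof. by rewrite mulr_sumr; apply: eq_bigr => i _; rewrite mxE mulrA. Qed.

Lemma dotNl x u : dot (- x) u = - dot x u.
Proof. by rewrite -scaleN1r dotZl mulN1r. Qed.

Lemma dotDr x y u : dot u (x + y) = dot u x + dot u y.
Proof. by rewrite dotC dotDl !(dotC _ u). Qed.

Lemma dotZr c x u : dot u (c *: x) = c * dot u x.
Proof. by rewrite dotC dotZl dotC. Qed.

Lemma dotNr x u : dot u (- x) = - dot u x.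
Proof. by rewrite dotC dotNl dotC. Qed.

Definition dotE := (dotDl, dotDr, dotZl, dotZr, dotNl, dotNr).

Lemma dot_ge0 x : 0 <= dot x x.
Proof. by apply: sumr_ge0 => i _; rewrite -expr2 sqr_ge0. Qed.

Lemma dot_eq0 x : (dot x x == 0) = (x == 0).
Proof.
apply/idP/eqP => [|->]; last by rewrite /dot big1// => i _; rewrite mxE mul0r.
rewrite psumr_eq0 => [/allP h|i _]; last by rewrite -expr2 sqr_ge0.
apply/rowP => i; have := h i (mem_index_enum _); rewrite -expr2 sqrf_eq0 mxE.
by move=> /eqP.
Qed.

Lemma dot_gt0 x : (0 < dot x x) = (x != 0).
Proof. by rewrite lt0r dot_ge0 andbT dot_eq0. Qed.

(** The ambient norm on row vectors is the max norm. The two norms bound each other up to the factor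
    [n], which is enough for continuity and compactness. *)
Definition enorm x := Num.sqrt (dot x x).

Lemma enorm_ge0 x : 0 <= enorm x. Proof. exact: sqrtr_ge0. Qed.

Lemma enorm_sqr x : enorm x ^+ 2 = dot x x.
Proof. by rewrite sqr_sqrtr// dot_ge0. Qed.

Lemma enormN x : enorm (- x) = enorm x.
Proof. by rewrite /enorm dotNl dotNr opprK. Qed.

Lemma enorm_le x (c : R) : 0 <= c -> (enorm x <= c) = (dot x x <= c ^+ 2).
Proof. by move=> c0; rewrite -enorm_sqr ler_sqr// nnegrE enorm_ge0. Qed.

Lemma enormZ c x : enorm (c *: x) = `|c| * enorm x.
Proof. by rewrite /enorm dotZl dotZr mulrA -expr2 sqrtrM ?sqr_ge0// sqrtr_sqr. Qed.

(** Cauchy-Schwarz, by expanding the square of [enorm y *: x - enorm x *: y]. *)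
Lemma dot_le_enorm x y : dot x y <= enorm x * enorm y.
Proof.
have [->|x0] := eqVneq x 0.
  by rewrite -[0](scale0r (0 : 'rV[R]_n)) dotZl mul0r mulr_ge0// enorm_ge0.
have [->|y0] := eqVneq y 0.
  by rewrite -[0](scale0r (0 : 'rV[R]_n)) dotZr mul0r mulr_ge0// enorm_ge0.
have a0 : 0 < enorm x by rewrite sqrtr_gt0 dot_gt0.
have b0 : 0 < enorm y by rewrite sqrtr_gt0 dot_gt0.
have := dot_ge0 (enorm y *: x - enorm x *: y).
rewrite !dotE -!enorm_sqr (dotC y x) => h.
rewrite -subr_ge0 -(pmulr_rge0 _ (mulr_gt0 a0 b0)); nra.
Qed.

Lemma enormD x y : enorm (x + y) <= enorm x + enorm y.
Proof.
rewrite enorm_le ?addr_ge0 ?enorm_ge0// !dotE -!enorm_sqr (dotC y x).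
have := dot_le_enorm x y; nra.
Qed.

Lemma enormB_sub x y : enorm x - enorm y <= enorm (x - y).
Proof. by rewrite lerBlDr -{1}(subrK y x) enormD. Qed.

Lemma norm_le_enorm x : `|x| <= enorm x.
Proof.
apply: row_norm_le; first exact: enorm_ge0.
move=> i; rewrite -sqrtr_sqr ler_sqrt ?dot_ge0// /dot (bigD1 i)//= expr2 lerDl.
by apply: sumr_ge0 => j _; rewrite -expr2 sqr_ge0.
Qed.

Lemma enorm_le_norm x : enorm x <= n%:R * `|x|.
Proof.
rewrite enorm_le ?mulr_ge0//.
apply: (@le_trans _ _ (\sum_(i < n) `|x| ^+ 2)).
  apply: ler_sum => i _; rewrite -expr2 -real_normK ?num_real// ler_sqr ?nnegrE//.
  exact: ler_coord_norm.
rewrite sumr_const card_ord exprMn -[leLHS]mulr_natl ler_wpM2r ?sqr_ge0//.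
by rewrite -natrX ler_nat; case: (n) => // k; rewrite expnS expn1 leq_pmulr.
Qed.

Definition eball (r : R) : set 'rV[R]_n := [set x | enorm x <= r].

Lemma unit_ballE : @unit_ball R n = eball 1.
Proof.
apply/seteqP; split=> x; rewrite /unit_ball /eball /= enorm_le// expr1n;
  by under eq_bigr do rewrite expr2.
Qed.

Lemma enorm_lipschitz x y : `|enorm x - enorm y| <= n%:R * `|x - y|.
Proof.
apply: le_trans (enorm_le_norm _); rewrite ler_norml enormB_sub andbT lerNl opprB.
by rewrite -[enorm (x - y)]enormN opprB enormB_sub.
Qed.

Lemma eball_compact r : compact (eball r).
Proof.
apply: bounded_closed_compact.
  exists r; split; first exact: num_real.
  by move=> M rM x xr; apply: le_trans (ltW rM); apply: le_trans xr; exact: norm_le_enorm.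
apply: (@closed_comp _ _ enorm [set t | t <= r]); last exact: closed_le.
move=> x _; apply: (@lipschitz_continuous R _ _ _ n%:R); exact: enorm_lipschitz.
Qed.

End Euclid.

(** * Steiner symmetrization *)

Section Steiner.
Variables (R : realType) (n : nat).
Implicit Types (x y u : 'rV[R]_n) (K : set 'rV[R]_n).

(* The chord of K on the line x + Ru is recentred at the hyperplane orthogonal to u. *)
Definition steiner u K : set 'rV[R]_n :=
  [set x | exists a b : R, [/\ K (x + a *: u), K (x + b *: u) &
    2 * `|dot x u| <= (b - a) * dot u u]].

Definition reflect u x := x - (2 * (dot x u / dot u u)) *: u.

Lemma dot_reflect u x : u != 0 -> dot (reflect u x) (reflect u x) = dot x x.
Proof.
rewrite -dot_gt0 /reflect !dotE (dotC u x) => u0; field.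
by rewrite gt_eqF.
Qed.

Lemma steiner_convex u K : convex_set K -> convex_set (steiner u K).
Proof.
move=> cK x y t [a [b [xa xb ab]]] [a' [b' [ya yb ab']]] t0 t1.
exists (t * a + (1 - t) * a'), (t * b + (1 - t) * b'); split.
- have := cK _ _ _ xa ya t0 t1; congr K.
  by apply/rowP => i; rewrite !mxE; ring.
- have := cK _ _ _ xb yb t0 t1; congr K.
  by apply/rowP => i; rewrite !mxE; ring.
- rewrite dotDl !dotZl (le_trans (ler_wpM2l _ (ler_normD _ _)))//.
  rewrite !normrM (ger0_norm t0) (@ger0_norm _ (1 - t)) ?subr_ge0//.
  nra.
Qed.

Lemma steiner_sym u K : sym_about 0 K -> sym_about 0 (steiner u K).
Proof.
move=> sK x [a [b [xa xb ab]]]; rewrite scaler0 sub0r.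
exists (- b), (- a); split.
- by have := sK _ xb; rewrite scaler0 sub0r opprD scaleNr.
- by have := sK _ xa; rewrite scaler0 sub0r opprD scaleNr.
- by rewrite dotNl normrN opprK addrC.
Qed.

(** A point of the ball and its mirror image both lie in [K], and they are exactly as far apart as
    the definition asks. *)
Lemma steiner_eball_sub u K r : u != 0 -> eball r `<=` K -> eball r `<=` steiner u K.
Proof.
move=> u0 rK x xr; have uu : 0 < dot u u by rewrite dot_gt0.
have Kx : K (x + 0 *: u) by rewrite scale0r addr0; exact: rK.
have Krx : K (x + (- (2 * (dot x u / dot u u))) *: u).
  by rewrite scaleNr; apply: rK; rewrite /eball /= /enorm dot_reflect.
have [xu|xu] := leP 0 (dot x u).
  exists (- (2 * (dot x u / dot u u))), 0; split=> //.
  by rewrite sub0r opprK mulrA mulfVK ?gt_eqF// ger0_norm.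
exists 0, (- (2 * (dot x u / dot u u))); split=> //.
by rewrite subr0 mulNr mulrA mulfVK ?gt_eqF// ltr0_norm// mulrN.
Qed.

(** Close to the sphere of radius [rho], both [x] and its mirror image are close to [K]; this is how
    a missing cap spreads. With [t] the height of [x] over the mirror, in units of [u], the ends of
    the chord have squared norms [X + (b ^+ 2 + 2 * b * t) * U] and [X + (a ^+ 2 + 2 * a * t) * U].
    Both are at most [rho ^+ 2], and one of them dominates each displacement. *)
Lemma steiner_near u K rho x : u != 0 -> K `<=` eball rho -> steiner u K x ->
  exists p q, [/\ K p, K q, dot (x - p) (x - p) <= rho ^+ 2 - dot x x &
    dot (reflect u x - q) (reflect u x - q) <= rho ^+ 2 - dot x x].
Proof.
move=> u0 Kr [a [b [xa xb ab]]]; have uu : 0 < dot u u by rewrite dot_gt0.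
have rho0 : 0 <= rho by apply: le_trans (enorm_ge0 _) (Kr _ xa).
have := Kr _ xa; have := Kr _ xb.
rewrite /eball /= !enorm_le// !dotE (dotC u x).
set s := dot x u in ab *; set U := dot u u in uu ab *; set X := dot x x => hb ha.
set t := s / U; have st : s = t * U by rewrite divfK// gt_eqF.
have E c : dot (x - (x + c *: u)) (x - (x + c *: u)) = c ^+ 2 * U.
  by rewrite opprD addrA subrr sub0r dotNl dotNr opprK !dotE -/U; ring.
have E' c : dot (reflect u x - (x + c *: u)) (reflect u x - (x + c *: u)) = (c + 2 * t) ^+ 2 * U.
  rewrite /reflect -/s -/U -/t opprD addrACA subrr add0r -opprD -scalerDl dotNl dotNr opprK !dotE -/U; ring.
have hb' : X + (b ^+ 2 + 2 * b * t) * U <= rho ^+ 2 by move: hb; rewrite st; nra.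
have ha' : X + (a ^+ 2 + 2 * a * t) * U <= rho ^+ 2 by move: ha; rewrite st; nra.
have ab' : 2 * `|t| <= b - a by move: ab; rewrite st normrM (gtr0_norm uu) mulrA ler_pM2r.
have key c : (c ^+ 2 <= b ^+ 2 + 2 * b * t) \/ (c ^+ 2 <= a ^+ 2 + 2 * a * t) -> c ^+ 2 * U <= rho ^+ 2 - X.
  case=> h; rewrite lerBrDl; [apply: le_trans hb' | apply: le_trans ha']; by rewrite lerD2l ler_wpM2r// ltW.
(* The sign of [t] decides which end approximates [x] and which its mirror image. *)
have [t0|t0] := leP 0 t; [rewrite ger0_norm// in ab'|rewrite ltr0_norm// in ab'].
  exists (x + b *: u), (x + a *: u); split=> //; rewrite ?E ?E'; apply: key.
    have [?|?] := leP 0 b; [left|right]; nra.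
  have [?|?] := leP 0 (a + 2 * t); [left|right]; nra.
exists (x + a *: u), (x + b *: u); split=> //; rewrite ?E ?E'; apply: key.
  have [?|?] := leP 0 a; [left|right]; nra.
have [?|?] := leP 0 (b + 2 * t); [left|right]; nra.
Qed.

Lemma steiner_sub_eball u K rho : u != 0 -> K `<=` eball rho -> steiner u K `<=` eball rho.
Proof.
move=> u0 Kr x Sx; have [p [q [Kp _ h _]]] := steiner_near u0 Kr Sx.
have rho0 : 0 <= rho by apply: le_trans (enorm_ge0 _) (Kr _ Kp).
by rewrite /eball /= enorm_le// -subr_ge0; apply: le_trans h; exact: dot_ge0.
Qed.

Lemma dot_lipschitz u x y : `|dot x u - dot y u| <= (\sum_i `|u 0 i|) * `|x - y|.
Proof.
rewrite -sumrB (le_trans (ler_norm_sum _ _ _))// mulr_suml ler_sum// => i _.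
rewrite -mulrBl normrM mulrC ler_wpM2l//; have := ler_coord_norm (x - y) i; by rewrite !mxE.
Qed.

End Steiner.

Section SteinerCompact.
Variable R : realType.

Lemma compact_eball n (K : set 'rV[R]_n) : compact K -> exists2 r : R, 0 < r & K `<=` eball r.
Proof.
move=> /compact_norm_le [M M0 KM]; exists (n%:R * M + 1).
  by rewrite ltr_wpDl// mulr_ge0// ltW.
move=> x /KM xM; rewrite /eball /= (le_trans (enorm_le_norm x))//.
by apply: (@le_trans _ _ (n%:R * M)); rewrite ?ler_wpM2l// lerDl.
Qed.

(** The existential quantifiers describe a projection: the symmetral is the image of a compact set
    of triples made of an end of a chord in [K], the difference of the parameters of its ends, and a
    shift along [u]. *)
Lemma steiner_compact n (u : 'rV[R]_n) (K : set 'rV[R]_n) : u != 0 -> compact K -> compact (steiner u K).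
Proof.
move=> u0 coK; have uu : 0 < dot u u by rewrite dot_gt0.
have nu : 0 < enorm u by rewrite sqrtr_gt0.
have [r r0 Kr] := compact_eball coK.
pose E := ('rV[R]_n * (R * R))%type.
pose C := [set z : E | [/\ K z.1, K (z.1 + z.2.1 *: u) &
  2 * `|dot (z.1 + z.2.2 *: u) u| <= z.2.1 * dot u u]].
pose f (z : E) := z.1 + z.2.2 *: u.
have CE : steiner u K = f @` C.
  apply/seteqP; split=> x.
    move=> [a [b [xa xb ab]]]; exists (x + a *: u, (b - a, - a)); rewrite /f /=.
      by split; rewrite /= ?scaleNr ?scalerBl ?addrA ?addrK// addrAC addrK.
    by rewrite scaleNr addrK.
  move=> [[p [l t]] [/= Kp Kpl h] <-]; rewrite /f /=.
  exists (- t), (l - t); split; rewrite ?scaleNr ?scalerBl.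
  - by rewrite addrK.
  - by rewrite addrACA subrr addr0.
  - by rewrite opprK subrK.
have n1 (z z' : E) : `|z.1 - z'.1| <= `|z - z'| by rewrite [leRHS]prod_normE /= le_max lexx.
have n2 (z z' : E) : `|z.2.1 - z'.2.1| <= `|z - z'|.
  by rewrite [leRHS]prod_normE /= le_max; apply/orP; right; rewrite [leRHS]prod_normE /= le_max lexx.
have n3 (z z' : E) : `|z.2.2 - z'.2.2| <= `|z - z'|.
  by rewrite [leRHS]prod_normE /= le_max; apply/orP; right; rewrite [leRHS]prod_normE /= le_max lexx orbT.
have lin (g : E -> R) : (forall z z', `|g z - g z'| <= `|z - z'|) ->
    forall z z', `|z.1 + g z *: u - (z'.1 + g z' *: u)| <= (1 + `|u|) * `|z - z'|.
  move=> hg z z'; rewrite opprD addrACA -scalerBl (le_trans (ler_normD _ _))// mulrDl mul1r.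
  by rewrite lerD// normrZ mulrC ler_wpM2l.
have cf : continuous f by apply: (@lipschitz_continuous R E _ _ (1 + `|u|)); exact: lin.
have cK : closed K by exact: compact_closed.
rewrite CE; apply: continuous_compact; first exact: continuous_subspaceT.
(* Two points of the ball of radius [r] on a line parallel to [u] differ by at most [L] times
   [u]. *)
pose L := 2 * r / enorm u.
apply: (@subclosed_compact _ _ (K `*` (`[- L, L]%classic `*` `[- L, L]%classic))).
- have -> : C = (fun z : E => z.1) @^-1` K `&` (fun z : E => z.1 + z.2.1 *: u) @^-1` K `&`
     (fun z : E => z.2.1 * dot u u - 2 * `|dot (f z) u|) @^-1` [set t | 0 <= t].
    by apply/seteqP; split=> z; rewrite /C /= subr_ge0; [case | case=> -[]].
  apply: closedI; first apply: closedI.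
  + by apply: closed_comp => // z _; apply: (@lipschitz_continuous R E _ _ 1) => *; rewrite mul1r.
  + by apply: closed_comp => // z _; apply: (@lipschitz_continuous R E _ _ (1 + `|u|)); exact: lin.
  + apply: closed_comp; last exact: closed_ge.
    move=> z _; pose D := \sum_i `|u 0 i|.
    apply: (@lipschitz_continuous R E _ _ (dot u u + 2 * (D * (1 + `|u|)))) => {}z z'.
    have -> : z.2.1 * dot u u - 2 * `|dot (f z) u| - (z'.2.1 * dot u u - 2 * `|dot (f z') u|) =
        (z.2.1 - z'.2.1) * dot u u + 2 * (`|dot (f z') u| - `|dot (f z) u|) by ring.
    rewrite (le_trans (ler_normD _ _))// [leRHS]mulrDl.
    rewrite !normrM (ger0_norm (dot_ge0 u)) (@ger0_norm _ 2)// lerD//.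
      by rewrite mulrC ler_wpM2l// dot_ge0.
    rewrite -mulrA ler_wpM2l//; apply: (le_trans (ler_dist_dist _ _)).
    apply: (le_trans (dot_lipschitz _ _ _)).
    rewrite -mulrA ler_wpM2l//; last by rewrite (distrC z); exact: (lin (fun z => z.2.2)).
    by apply: sumr_ge0.
- by apply: compact_setX => //; apply: compact_setX; exact: segment_compact.
- have LL (t : R) x y : eball r x -> eball r y -> t *: u = x - y -> t \in `[- L, L].
    move=> xr yr e; rewrite in_itv /= -ler_norml /L ler_pdivlMr// -enormZ e.
    by rewrite (le_trans (enormD _ _))// enormN mulr2n mulrDl !mul1r lerD.
  move=> z Cz; have Sf : steiner u K (f z) by rewrite CE; exists z.
  have [K1 K2 _] := Cz; split=> //; split=> /=.
    by apply: (LL _ _ _ (Kr _ K2) (Kr _ K1)); rewrite addrAC subrr add0r.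
  by apply: (LL _ _ _ (steiner_sub_eball u0 Kr Sf) (Kr _ K1)); rewrite /f addrAC subrr add0r.
Qed.

End SteinerCompact.

(** * Volumes and inscribed polytopes under symmetrization *)

Section SteinerVolume.
Variables (R : realType) (n m : nat).
Notation V := 'rV[R]_n.+1.
Notation lambda := (@lebesgue_measure R).

Lemma chord_length_ge (A : set V) (u x : V) (s t : R) : convex_set A -> compact A ->
  chord A u x s -> chord A u x t -> (`|t - s|%:E <= lambda (chord A u x))%E.
Proof.
move=> cA coA; wlog st : s t / s <= t.
  move=> W As At; have [st|/ltW ts] := leP s t; first exact: W.
  by rewrite distrC; exact: W.
move=> As At; rewrite ger0_norm ?subr_ge0//.
have e : lambda `[s, t]%classic = (t - s)%:E.
  rewrite lebesgue_measure_itv /= lte_fin; case: ltP => [|ts]; first by rewrite EFinB.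
  by congr EFin; apply/eqP; rewrite eq_sym subr_eq0 eq_le ts st.
rewrite -e; apply: le_measure; rewrite ?inE; [exact: measurable_itv | exact: measurable_chord|].
move=> z /=; rewrite in_itv /= => /andP[sz zt].
have [est|nst] := eqVneq s t.
  by rewrite (_ : z = s)//; apply/eqP; rewrite eq_le sz est zt.
have d0 : 0 < t - s by rewrite subr_gt0 lt_neqAle nst st.
have := cA _ _ ((z - s) / (t - s)) At As.
rewrite divr_ge0 ?subr_ge0//.
rewrite ler_pdivrMr// mul1r lerD2r zt => /(_ erefl erefl).
rewrite /chord /=; congr A; apply/rowP => i; rewrite !mxE; field.
by rewrite gt_eqF.
Qed.

(** A bounded set of reals lies in an interval as long as its diameter, ending at its supremum. *)
Lemma chord_length_le (A : set V) (u x : V) (M : \bar R) : compact A -> (0 <= M)%E ->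
  (forall s t, chord A u x s -> chord A u x t -> s <= t -> ((2 * (t - s))%:E <= M)%E) ->
  (2%:E * lambda (chord A u x) <= M)%E.
Proof.
move=> coA M0 h; set F := chord A u x in h *.
have mF : measurable F by exact: measurable_chord.
have [F0|/set0P [s0 Fs0]] := eqVneq F set0; first by rewrite F0 measure0 mule0.
case: M M0 h => [M M0 h|_ _|]; [|by rewrite leey|by []].
rewrite lee_fin in M0.
have hM s t : F s -> F t -> t <= s + M / 2.
  move=> Fs Ft; have [st|/ltW ts] := leP s t; last by rewrite (le_trans ts)// lerDl divr_ge0.
  by have := h _ _ Fs Ft st; rewrite lee_fin; lra.
have sF : has_sup F by split; [exists s0 | exists (s0 + M / 2) => t Ft; exact: hM].
have FI : F `<=` `[sup F - M / 2, sup F]%classic.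
  move=> t Ft /=; rewrite in_itv /=; apply/andP; split; last exact: sup_upper_bound.
  by rewrite lerBlDr; apply: ge_sup; [exists s0 | move=> s Fs; exact: hM].
have le : (lambda F <= (M / 2)%:E)%E.
  have -> : (M / 2)%:E = lambda `[sup F - M / 2, sup F]%classic.
    rewrite lebesgue_measure_itv /= lte_fin; case: ltP => [_|hs].
      by rewrite -EFinB opprB addrCA subrr addr0.
    by congr EFin; lra.
  by apply: le_measure; rewrite ?inE//; exact: measurable_itv.
apply: (@le_trans _ _ (2%:E * (M / 2)%:E)%E); first by rewrite lee_pmul2l.
by rewrite -EFinM lee_fin mulrC divfK.
Qed.

(** Each chord of [K] reappears recentred in the symmetral, so [cavalieri] applies with the
    symmetral in both places on the right. *)
Lemma vol_le_steiner (K : set V) (u : V) j : u 0 j = 1 -> convex_set K -> compact K ->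
  (vol K <= vol (steiner u K))%E.
Proof.
move=> uj cK coK.
have u0 : u != 0 by apply/eqP => uE; move: uj; rewrite uE mxE => /eqP; rewrite eq_sym oner_eq0.
have uu : 0 < dot u u by rewrite dot_gt0.
have coS := steiner_compact u0 coK; have cS := @steiner_convex _ _ u _ cK.
have : (2%:E * vol K <= vol (steiner u K) + vol (steiner u K))%E.
  apply: (cavalieri uj) => // x.
  apply: chord_length_le => // [|s t Ks Kt st]; first exact: adde_ge0.
  (* The line meets the mirror at parameter [- c], and [d] is half the length of the recentred
     chord. *)
  pose c := dot x u / dot u u; pose d := (t - s) / 2.
  have xu : dot x u = c * dot u u by rewrite divfK// gt_eqF.
  have inS e : `|e| <= d -> chord (steiner u K) u x (e - c).
    move=> ed; exists (s - (e - c)), (t - (e - c)); split.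
    - by rewrite -addrA -scalerDl addrCA subrr addr0.
    - by rewrite -addrA -scalerDl addrCA subrr addr0.
    - rewrite dotDl dotZl xu -mulrDl addrC subrK normrM (gtr0_norm uu) mulrA.
      by rewrite ler_pM2r//; move: ed; rewrite /d; lra.
  have d0 : 0 <= d by rewrite /d divr_ge0// subr_ge0.
  have h1 : chord (steiner u K) u x (d - c) by apply: inS; rewrite ger0_norm.
  have h2 : chord (steiner u K) u x (- d - c) by apply: inS; rewrite normrN ger0_norm.
  have := chord_length_ge cS coS h2 h1.
  rewrite (_ : d - c - (- d - c) = t - s); last by rewrite /d; field.
  rewrite ger0_norm ?subr_ge0// => h; rewrite mulrDl !mul1r EFinD; exact: leeD.
have [_ _ fK] := compact_vol coK; have [_ _ fS] := compact_vol coS.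
by rewrite -(fineK fK) -(fineK fS) -EFinM -EFinD !lee_fin; lra.
Qed.

(* The vertices of a polytope in the symmetral are moved along u into K in two
   ways; along each chord the average of the two new lengths is at least the old one. *)
Lemma steiner_polytope (K P : set V) (u : V) j : u 0 j = 1 -> convex_set K -> compact K ->
  sym_about 0 K -> polytope_le m P -> sym_about 0 P -> P `<=` steiner u K ->
  exists Q, [/\ polytope_le m Q, Q `<=` K, sym_about 0 Q & (vol P <= vol Q)%E].
Proof.
move=> uj cK coK sK plP sP PS.
have u0 : u != 0 by apply/eqP => uE; move: uj; rewrite uE mxE => /eqP; rewrite eq_sym oner_eq0.
have uu : 0 < dot u u by rewrite dot_gt0.
have sK' x : K x -> K (- x) by move=> /sK; rewrite scaler0 sub0r.
have [k [v [km PE vsym]]] := symmetric_vertices plP sP.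
pose tau x := dot x u / dot u u.
have tauN x : tau (- x) = - tau x by rewrite /tau dotNl mulNr.
(* The second point is the mirror image of [x] shifted by the same [c]. An end of the chord serves
   as [c], since the chord has length at least [2 * |tau x|]. *)
have hc x : exists c, steiner u K x -> K (x + c *: u) /\ K (x + (c - 2 * tau x) *: u).
  have [Sx|nSx] := pselect (steiner u K x); last by exists 0.
  have [a [b [xa xb ab]]] := Sx.
  have tE : 2 * `|tau x| <= b - a.
    by rewrite /tau normrM normfV (gtr0_norm uu) mulrA ler_pdivrMr.
  have Kc c : a <= c <= b -> K (x + c *: u).
    move=> /andP[ac cb]; have [ba|nab] := eqVneq a b.
      by rewrite (_ : c = a)//; apply/eqP; rewrite eq_le ac ba cb.
    have d0 : 0 < b - a by rewrite subr_gt0 lt_neqAle nab (le_trans ac cb).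
    have := cK _ _ ((c - a) / (b - a)) xb xa.
    rewrite divr_ge0 ?subr_ge0 ?(ltW d0)//; last by rewrite -subr_ge0 ltW.
    rewrite ler_pdivrMr// mul1r lerD2r cb => /(_ erefl erefl).
    congr K; apply/rowP => i; rewrite !mxE; field.
    by rewrite gt_eqF.
  have [t0|t0] := leP 0 (tau x); [rewrite ger0_norm// in tE|rewrite ltr0_norm// in tE].
    by exists b => _; split; apply: Kc; lra.
  by exists a => _; split; apply: Kc; lra.
pose c0 x := projT1 (cid (hc x)).
have hc0 x : steiner u K x -> K (x + c0 x *: u) /\ K (x + (c0 x - 2 * tau x) *: u) := projT2 (cid (hc x)).
(* Averaging makes the shift odd. The moved points stay in [K]: each is the midpoint of a point of
   [K] and the opposite of another. *)
pose c x := (c0 x - c0 (- x)) / 2.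
have cN x : c (- x) = - c x by rewrite /c opprK -mulNr opprB.
pose q x := x + c x *: u.
pose q' x := x + (c x - 2 * tau x) *: u.
have qN x : q (- x) = - q x by rewrite /q cN scaleNr opprD.
have qN' x : q' (- x) = - q' x.
  by apply/rowP => i; rewrite /q' cN tauN !mxE; ring.
have mid x y : K x -> K y -> K (2^-1 *: x + 2^-1 *: y).
  move=> Kx Ky; have -> : 2^-1 *: y = (1 - 2^-1) *: y by congr (_ *: _); field.
  by apply: cK; rewrite ?invr_ge0// invf_le1// ler1n.
have Kq x : steiner u K x -> K (q x) /\ K (q' x).
  move=> Sx; have SNx := steiner_sym sK Sx; rewrite scaler0 sub0r in SNx.
  have [h1 h2] := hc0 _ Sx; have [/sK' h3 /sK' h4] := hc0 _ SNx.
  split; [have := mid _ _ h1 h3 | have := mid _ _ h2 h4];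
    congr K; apply/rowP => i; rewrite /q /q' /c ?tauN !mxE; by field.
pose w i := q (v i); pose w' i := q' (v i).
have Sv i : steiner u K (v i) by apply: PS; rewrite PE; exact: conv_hull_vertex.
have plw : polytope_le m (conv_hull w) by exists k, w.
have plw' : polytope_le m (conv_hull w') by exists k, w'.
have wK : conv_hull w `<=` K by apply: conv_hull_sub => // i; exact: (Kq _ (Sv i)).1.
have w'K : conv_hull w' `<=` K by apply: conv_hull_sub => // i; exact: (Kq _ (Sv i)).2.
have sw : sym_about 0 (conv_hull w).
  by apply: conv_hull_sym => i; have [l vl] := vsym i; exists l; rewrite /w vl qN.
have sw' : sym_about 0 (conv_hull w').
  by apply: conv_hull_sym => i; have [l vl] := vsym i; exists l; rewrite /w' vl qN'.
have coP : compact P by rewrite PE; exact: conv_hull_compact.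
have cow := @conv_hull_compact R _ _ w; have cow' := @conv_hull_compact R _ _ w'.
have : (2%:E * vol P <= vol (conv_hull w) + vol (conv_hull w'))%E.
  apply: (cavalieri uj) => // x.
  apply: chord_length_le => // [|s t]; first exact: adde_ge0.
  rewrite PE => -[l [l0 [l1 ls]]] [l' [l'0 [l'1 lt]]] st.
  pose C (l : 'I_k -> R) := \sum_i l i * c (v i).
  (* With the same weights [r], the moved vertices give points on the same line, displaced by the
     mean shift [C r]. Mirroring reverses the sign of [e] but not of [C r], so in the sum of the two
     lengths the shifts cancel and [2 * (t - s)] remains. *)
  have hw (r : 'I_k -> R) e : (forall i, 0 <= r i) -> \sum_i r i = 1 -> x + e *: u = \sum_i r i *: v i ->
      chord (conv_hull w) u x (e + C r) /\ chord (conv_hull w') u x (C r - e - 2 * tau x).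
    move=> r0 r1 re; split; exists r; split=> //; split=> //.
      rewrite scalerDl addrA re /C scaler_suml -big_split; apply: eq_bigr => i _ /=.
      by rewrite /w /q scalerDr scalerA.
    have tl : \sum_i r i * tau (v i) = tau x + e.
      rewrite /tau; under eq_bigr do rewrite mulrA -dotZl.
      rewrite -mulr_suml (_ : \sum_i dot _ _ = dot (x + e *: u) u).
        by rewrite dotDl dotZl mulrDl mulfK// gt_eqF.
      by rewrite re (big_morph (fun z => dot z u) (fun a b => dotDl a b u) (_ : dot 0 u = 0))// -(scale0r u) dotZl mul0r.
    have -> : C r - e - 2 * tau x = e + (C r - 2 * (tau x + e)) by ring.
    rewrite scalerDl addrA re -tl /C mulr_sumr -sumrB scaler_suml -big_split; apply: eq_bigr => i _ /=.
    by rewrite /w' /q' scalerDr scalerA; congr (_ + _ *: _); ring.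
  have [a1 a2] := hw _ _ l0 l1 ls; have [b1 b2] := hw _ _ l'0 l'1 lt.
  have := chord_length_ge (@conv_hull_convex _ _ _ w) cow a1 b1.
  have := chord_length_ge (@conv_hull_convex _ _ _ w') cow' b2 a2.
  move=> h2 h1; apply: le_trans (leeD h1 h2); rewrite -EFinD lee_fin.
  apply: (@le_trans _ _ ((t + C l' - (s + C l)) + (C l - s - 2 * tau x - (C l' - t - 2 * tau x)))).
    by lra.
  by apply: lerD; exact: ler_norm.
have [_ _ fP] := compact_vol coP; have [_ _ fw] := compact_vol cow; have [_ _ fw'] := compact_vol cow'.
rewrite -(fineK fP) -(fineK fw) -(fineK fw') -EFinM -EFinD lee_fin => h.
have [h'|h'] := leP (fine (vol P)) (fine (vol (conv_hull w))).
  by exists (conv_hull w); split=> //; rewrite -(fineK fP) -(fineK fw) lee_fin.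
exists (conv_hull w'); split=> //; rewrite -(fineK fP) -(fineK fw') lee_fin; lra.
Qed.

End SteinerVolume.

(** * Rounding a body by finitely many symmetrizations *)

Section Rounding.
Variables (R : realType) (n m : nat).
Notation V := 'rV[R]_n.+1.
Implicit Types (K : set V) (x y z w : V).

Definition sym_body K := [/\ convex_set K, compact K & sym_about 0 K].

(* If worse K K', then psi_m(K) is at least psi_m(K'). *)
Definition worse K K' := (vol K <= vol K')%E /\
  forall P, polytope_le m P -> sym_about 0 P -> P `<=` K' ->
    exists Q, [/\ polytope_le m Q, Q `<=` K, sym_about 0 Q & (vol P <= vol Q)%E].

Lemma worse_refl K : worse K K.
Proof. by split=> // P plP sP PK; exists P. Qed.

Lemma worse_trans K1 K2 K3 : worse K1 K2 -> worse K2 K3 -> worse K1 K3.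
Proof.
move=> [v12 h12] [v23 h23]; split; first exact: le_trans v23.
move=> P plP sP /(h23 _ plP sP) [Q [plQ QK2 sQ PQ]].
have [Q' [? ? ? QQ']] := h12 _ plQ sQ QK2.
by exists Q'; split=> //; exact: le_trans QQ'.
Qed.

(** What symmetrization preserves is recorded, rather than the chain of directions. The inner ball
    keeps the outer radii away from 0. *)
Definition reachable (c rho : R) K K' :=
  [/\ sym_body K', worse K K', eball c `<=` K' & K' `<=` eball rho].

(** As [z0] and [z] have the same norm, reflection along [z0 - z] exchanges them, so the mirror
    image of [x] is as far from [z0] as [x] is from [z]. *)
Lemma steiner_step c rho K z0 z : sym_body K -> eball c `<=` K -> K `<=` eball rho ->
  dot z0 z0 = dot z z -> z0 != z ->
  exists2 K', reachable c rho K K' & forall x, K' x ->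
    (exists2 p, K p & dot (x - p) (x - p) <= rho ^+ 2 - dot x x) /\
    (exists y q, [/\ K q, dot y y = dot x x, dot (y - z0) (y - z0) = dot (x - z) (x - z) &
       dot (y - q) (y - q) <= rho ^+ 2 - dot x x]).
Proof.
move=> [cK coK sK] cKc Kr zz zn.
pose u0 := z0 - z.
have u00 : u0 != 0 by rewrite subr_eq0.
have [j uj] : exists j, u0 0 j != 0.
  apply/existsP; rewrite -[X in is_true X]negbK negb_exists; apply/negP => /forallP h.
  by move/eqP: u00; apply; apply/rowP => j; rewrite [RHS]mxE; apply/eqP; have := h j; rewrite negbK.
(* Scaled to have a coordinate 1, as [cavalieri] demands; the reflection is unaffected. *)
pose u := (u0 0 j)^-1 *: u0.
have uj1 : u 0 j = 1 by rewrite mxE mulVf.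
have un0 : u != 0 by rewrite scaler_eq0 invr_eq0 negb_or uj.
have rE x : reflect u x = x - (2 * (dot x u0 / dot u0 u0)) *: u0.
  rewrite /reflect /u !(dotZl, dotZr) scalerA; congr (_ - _ *: _); field.
  by rewrite dot_eq0 u00 uj.
have rz : reflect u z = z0.
  rewrite rE; have -> : 2 * (dot z u0 / dot u0 u0) = -1.
    have e : dot u0 u0 = - (2 * dot z u0) by rewrite /u0 !dotE (dotC z0 z) zz; ring.
    have : dot u0 u0 != 0 by rewrite dot_eq0.
    by rewrite e oppr_eq0 => h; rewrite mulrA invrN mulrN divff.
  by rewrite scaleN1r opprK /u0 addrC subrK.
exists (steiner u K).
  split; last exact: steiner_sub_eball.
  - split; [exact: steiner_convex | exact: steiner_compact | exact: steiner_sym].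
  - split; first exact: vol_le_steiner uj1 cK coK.
    by move=> P plP sP PS; exact: steiner_polytope uj1 cK coK sK plP sP PS.
  - exact: steiner_eball_sub.
move=> x Sx; have [p [q [Kp Kq hp hq]]] := steiner_near un0 Kr Sx.
split; first by exists p.
exists (reflect u x), q; split=> //; first exact: dot_reflect.
rewrite -rz -(dot_reflect (x - z) un0).
rewrite (_ : reflect u x - reflect u z = reflect u (x - z))//.
by apply/rowP => i; rewrite /reflect !(dotDl, dotNl) !mxE; ring.
Qed.

(** The depth below the sphere is measured by [rho ^+ 2 - dot x x], the quantity that bounds
    displacements in [steiner_near]. *)
Definition avoids K (rho : R) z (eta d : R) :=
  forall x, K x -> rho ^+ 2 - dot x x <= d ^+ 2 -> eta <= enorm (x - z).

Lemma avoids_mono K rho z eta d eta' d' : eta' <= eta -> 0 <= d' <= d ->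
  avoids K rho z eta d -> avoids K rho z eta' d'.
Proof.
move=> ee /andP[d'0 dd] h x Kx xd; apply: le_trans ee _; apply: h => //.
apply: le_trans xd _; nra.
Qed.

(** A point [q] within [d'] of [y] sinks below the sphere by at most [2 * rho * d'] more than [x]
    and is at most [d'] farther from [z0] than [y]. Taking [y = x] keeps an old cap empty, taking
    the mirror image empties a new one. *)
Lemma avoids_near K K' rho z0 z eta d eta' d' : K' `<=` eball rho ->
  0 <= d' -> eta' + d' <= eta -> d' ^+ 2 + 2 * rho * d' <= d ^+ 2 ->
  (forall x, K' x -> exists y q, [/\ K q, dot y y = dot x x,
     dot (y - z0) (y - z0) = dot (x - z) (x - z) & dot (y - q) (y - q) <= rho ^+ 2 - dot x x]) ->
  avoids K rho z0 eta d -> avoids K' rho z eta' d'.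
Proof.
move=> K'r d'0 ee dd hK h x K'x xd.
have [y [q [Kq yx yz yq]]] := hK _ K'x.
have yqd : enorm (y - q) <= d' by rewrite enorm_le// (le_trans yq).
have xr : enorm x <= rho := K'r _ K'x.
have eyx : enorm y = enorm x by rewrite /enorm yx.
have qx : enorm x <= enorm q + d'.
  by rewrite -eyx -[y](subrK q) (le_trans (enormD _ _))// addrC lerD2l.
have x0 := enorm_ge0 x; have q0 := enorm_ge0 q.
have : eta <= enorm (q - z0).
  apply: h => //; apply: le_trans dd; rewrite -enorm_sqr.
  rewrite -enorm_sqr in xd.
  have h1 : enorm x * d' <= rho * d' by rewrite ler_wpM2r.
  have h2 : enorm x ^+ 2 - 2 * (enorm x * d') <= enorm q ^+ 2.
    have [xd'|xd'] := leP (enorm x) d'; first by nra.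
    have : (enorm x - d') ^+ 2 <= enorm q ^+ 2 by rewrite ler_sqr ?nnegrE; lra.
    by nra.
  lra.
have -> : enorm (x - z) = enorm (y - z0) by rewrite /enorm yz.
have : enorm (q - z0) <= enorm (q - y) + enorm (y - z0).
  by rewrite -{1}(subrK y q) -addrA enormD.
rewrite -[enorm (q - y)]enormN opprB; lra.
Qed.

(** [d'] is fixed before the body and [rho], so that [rho] may later be chosen close to an infimum
    in terms of it. *)
Lemma avoid_all (r : R) (zs : seq V) : 0 < r -> {in zs, forall z, dot z z = r ^+ 2} ->
  forall eta eta' d, eta' < eta -> 0 < d ->
  exists2 d', 0 < d' & forall c rho z0 K, rho <= 2 * r -> dot z0 z0 = r ^+ 2 ->
    sym_body K -> eball c `<=` K -> K `<=` eball rho -> avoids K rho z0 eta d ->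
    exists K', [/\ reachable c rho K K', avoids K' rho z0 eta' d' &
      {in zs, forall z, avoids K' rho z eta' d'}].
Proof.
move=> r0; elim: zs => [|z zs IH] zsr eta eta' d ee d0.
  exists d => // c rho z0 K rr z0r bK cK Kr h; exists K; split=> //.
    by split=> //; exact: worse_refl.
  by apply: avoids_mono h; rewrite ?lexx ltW.
have zsr' : {in zs, forall z, dot z z = r ^+ 2} by move=> w wzs; apply: zsr; rewrite inE wzs orbT.
have mid : (eta + eta') / 2 < eta by rewrite ltr_pdivrMr//; lra.
have [d1 d10 h1] := IH zsr' _ _ _ mid d0.
(* The first bound pays for the loss in [eta]. The others give [d' ^+ 2 + 2 * rho * d' <= d' * (d1 +
   4 * r) <= d1 ^+ 2], as [rho <= 2 * r]. *)
pose d' := Num.min ((eta - eta') / 2) (Num.min d1 (d1 ^+ 2 / (d1 + 4 * r))).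
have d4 : 0 < d1 + 4 * r by lra.
have d'0 : 0 < d'.
  by rewrite !lt_min d10 !divr_gt0 ?subr_gt0 ?exprn_gt0.
have d'1 : d' <= d1 by rewrite !ge_min lexx !orbT.
have d'e : d' <= (eta - eta') / 2 by rewrite !ge_min lexx.
have d'd : d' * (d1 + 4 * r) <= d1 ^+ 2 by rewrite -ler_pdivlMr// !ge_min lexx !orbT.
exists d' => // c rho z0 K rr z0r bK cK Kr h.
have [K1 [[bK1 wK1 cK1 K1r] a0 azs]] := h1 c rho z0 K rr z0r bK cK Kr h.
have mono w : avoids K1 rho w ((eta + eta') / 2) d1 -> avoids K1 rho w eta' d'.
  by apply: avoids_mono; [lra | rewrite d'1 ltW].
(* If [z = z0] there is no direction to symmetrize along, but this cap is already empty. *)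
have [zz0|zz0] := eqVneq z0 z.
  exists K1; split=> //; first exact: mono.
  by move=> w; rewrite inE => /orP[/eqP ->|wzs]; [rewrite -zz0; exact: mono | exact/mono/azs].
have zr : dot z0 z0 = dot z z by rewrite z0r zsr// mem_head.
have [K2 [bK2 wK2 cK2 K2r] near2] := steiner_step bK1 cK1 K1r zr zz0.
have dd : d' ^+ 2 + 2 * rho * d' <= d1 ^+ 2 by nra.
have eed : eta' + d' <= (eta + eta') / 2 by lra.
have keep w : avoids K1 rho w ((eta + eta') / 2) d1 -> avoids K2 rho w eta' d'.
  apply: avoids_near => //; first exact: ltW.
  by move=> x /near2 [[p Kp xp] _]; exists x, p.
exists K2; split.
- by split=> //; exact: worse_trans wK2.
- exact: keep.
- move=> w; rewrite inE => /orP[/eqP ->|/azs]; last exact: keep.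
  apply: (avoids_near K2r _ eed dd _ a0); first exact: ltW.
  by move=> x /near2 [].
Qed.

Lemma sphere_net (r e : R) : 0 < e -> exists zs : seq V,
  {in zs, forall z, dot z z = r ^+ 2} /\
  forall x, dot x x = r ^+ 2 -> exists2 z, z \in zs & enorm (x - z) < e.
Proof.
move=> e0; pose S := [set x : V | enorm x = `|r|].
have SE x : S x <-> dot x x = r ^+ 2.
  rewrite /S /= -enorm_sqr; split=> [->|h]; first by rewrite real_normK ?num_real.
  by rewrite -sqrtr_sqr -h sqrtr_sqr ger0_norm// enorm_ge0.
have coS : compact S.
  apply: (subclosed_compact _ (@eball_compact R n.+1 `|r|)); last by move=> x; rewrite /S /eball /= => ->.
  apply: (@closed_comp _ _ (@enorm R n.+1) [set `|r|]); last exact: closed_eq.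
  move=> x _; apply: (@lipschitz_continuous R _ _ _ n.+1%:R); exact: enorm_lipschitz.
rewrite compact_cover in coS.
(* [ball] refers to the max norm; the divisor absorbs the factor in [enorm_le_norm]. *)
pose e' := e / n.+1%:R.
have e'0 : 0 < e' by rewrite divr_gt0.
have [||D DS cov] := coS V S (fun z => ball z e').
- by move=> z _; exact: ball_open.
- by move=> x Sx; exists x => //; exact: ballxx.
exists (finmap.enum_fset D); split=> [z zD|x /SE Sx].
  by apply/SE; have := DS z zD; rewrite inE.
have [z zD xz] := cov _ Sx; exists z => //.
apply: le_lt_trans (enorm_le_norm _) _.
move: xz; rewrite -ball_normE /= distrC => xz.
by rewrite mulrC -ltr_pdivlMr.
Qed.

(** The normal points from the nearest point [p] of [K] to [q]. *)
Lemma separation K q : convex_set K -> compact K -> K !=set0 -> ~ K q ->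
  exists2 w, enorm w = 1 & forall x, K x -> dot x w <= dot q w.
Proof.
move=> cK coK K0 nKq.
have [p pK pmin] : exists2 p, p \in K & forall x, x \in K -> enorm (p - q) <= enorm (x - q).
  apply: (@EVT_min_rV R n.+1 (fun x => enorm (x - q))) => //.
  apply: continuous_subspaceT; apply: (@lipschitz_continuous R _ _ _ n.+1%:R) => x y.
  by apply: le_trans (enorm_lipschitz _ _) _; rewrite opprB addrA subrK.
rewrite inE in pK.
pose v := q - p.
have v0 : v != 0 by rewrite subr_eq0; apply/eqP => qp; apply: nKq; rewrite qp.
have hv x : K x -> dot (x - p) v <= 0.
  move=> Kx; rewrite leNgt; apply/negP; set a := dot _ _ => a0.
  pose D := dot (x - p) (x - p); have D0 : 0 <= D by exact: dot_ge0.
  have aD : 0 < a + D by lra.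
  (* Then [t * D <= a], so moving from [p] towards [x] changes the squared distance to [q] by at
     most [- t * a], which is negative. The summand [a] in the denominator keeps [t <= 1]. *)
  pose t := a / (a + D).
  have t0 : 0 < t by rewrite divr_gt0.
  have t1 : t <= 1 by rewrite ler_pdivrMr// mul1r lerDl.
  have tD : t * (a + D) = a by rewrite divfK// gt_eqF.
  have Kt : K (t *: x + (1 - t) *: p) by apply: cK => //; exact: ltW.
  have := pmin _ (mem_set Kt).
  have -> : t *: x + (1 - t) *: p - q = t *: (x - p) - v.
    by apply/rowP => i; rewrite !mxE; ring.
  have -> : p - q = - v by rewrite /v opprB.
  have dE y y' : dot (t *: y - y') (t *: y - y') = t ^+ 2 * dot y y - 2 * (t * dot y y') + dot y' y'.
    by rewrite !dotE (dotC y' y); ring.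
  rewrite enormN enorm_le ?enorm_ge0// enorm_sqr dE -/a -/D.
  have : t * (t * D) <= t * a by rewrite ler_pM2l//; nra.
  nra.
exists ((enorm v)^-1 *: v).
  by rewrite enormZ ger0_norm ?invr_ge0 ?enorm_ge0// mulVf// gt_eqF// sqrtr_gt0 dot_gt0.
move=> x Kx; rewrite !dotZr ler_wpM2l ?invr_ge0 ?enorm_ge0//.
have vv : dot v v = dot q v - dot p v by rewrite -dotNl -dotDl.
have := hv _ Kx; have := dot_ge0 v; rewrite vv dotDl dotNl; lra.
Qed.


Lemma enorm_e0 (c : R) : 0 <= c -> enorm (c *: delta_mx 0 0 : V) = c.
Proof.
move=> c0; rewrite enormZ ger0_norm// /enorm /dot (bigD1 0)//= !mxE /= mulr1.
by rewrite big1 ?addr0 ?sqrtr1 ?mulr1// => i i0; rewrite !mxE (negPf i0) andbF mulr0.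
Qed.

(* Otherwise let r be the infimal radius of balls containing a reachable body.
   A body close to that radius misses a cap, and reflecting the cap around the
   whole sphere makes it fit into a smaller ball. *)
Lemma rounding K (c e : R) : 0 < c -> 0 < e -> e < 1 -> sym_body K -> eball c `<=` K ->
  exists K' rho, [/\ 0 < rho, sym_body K', worse K K', eball ((1 - e) * rho) `<=` K' & K' `<=` eball rho].
Proof.
move=> c0 e0 e1 bK cK; apply: contrapT => none.
pose E := [set rho : R | exists K', reachable c rho K K'].
have Ec : lbound E c.
  move=> rho [K' [_ _ cK' K'r]].
  have : eball rho (c *: delta_mx 0 0 : V) by apply: K'r; apply: cK'; rewrite /eball /= enorm_e0// ltW.
  by rewrite /eball /= enorm_e0// ltW.
have [r0 r00 Kr0] : exists2 r : R, 0 < r & K `<=` eball r.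
  by have [_ coK _] := bK; exact: compact_eball.
have E0 : E !=set0 by exists r0, K; split=> //; exact: worse_refl.
have iE : has_inf E by split=> //; exists c.
pose r := inf E.
have cr : c <= r by exact: lb_le_inf.
have rp : 0 < r by exact: lt_le_trans cr.
pose eta := r * e / 2; pose eta' := eta / 2.
have eta0 : 0 < eta by rewrite divr_gt0// mulr_gt0.
have eta'0 : 0 < eta' by rewrite divr_gt0.
have ee : eta' < eta by rewrite ltr_pdivrMr//; lra.
have eta'20 : 0 < eta' / 2 by rewrite divr_gt0.
have [zs [zsr net]] := @sphere_net r _ eta'20.
have [d1 d10 hd1] := avoid_all rp zsr ee ltr01.
(* Points less deep than [d] have norm within [eta' / 4] of [r]; adding the mesh [eta' / 2] of the
   net stays below [eta']. *)
pose d := Num.min d1 (Num.min (eta' / 4) (r / 2)).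
have d0 : 0 < d by rewrite /d !lt_min d10 (divr_gt0 eta'0)//= divr_gt0.
have dd1 : d <= d1 by rewrite !ge_min lexx.
have de : d <= eta' / 4 by rewrite !ge_min lexx !orbT.
have dr : d <= r / 2 by rewrite !ge_min lexx !orbT.
(* The slack over the infimum. The last bound gives [(r + s) ^+ 2 - d ^+ 2 < r ^+ 2], the final
   contradiction. *)
pose s := Num.min (Num.min r (eta' / 4)) (Num.min (r * e / 2) (d ^+ 2 / (4 * r))).
have s0 : 0 < s by rewrite /s !lt_min rp (divr_gt0 eta'0)//= -/eta eta0 divr_gt0 ?exprn_gt0 ?mulr_gt0.
have sr : s <= r by rewrite !ge_min lexx.
have se : s <= eta' / 4 by rewrite !ge_min lexx !orbT.
have se2 : s <= r * e / 2 by rewrite !ge_min lexx !orbT.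
have sd : s * (4 * r) <= d ^+ 2 by rewrite -ler_pdivlMr ?mulr_gt0// !ge_min lexx !orbT.
have [rho [K1 [bK1 wK1 cK1 K1r]] rhos] := inf_adherent s0 iE.
have rrho : r <= rho by apply: ge_inf; [exists c | exists K1].
have [q qr nKq] : exists2 q, eball ((1 - e) * rho) q & ~ K1 q.
  apply: contrapT => h; apply: none; exists K1, rho; split=> //; first exact: lt_le_trans rrho.
  by move=> x xr; apply: contrapT => nKx; apply: h; exists x.
have [cvK1 coK1 _] := bK1.
have K10 : K1 !=set0.
  by exists 0; apply: cK1; rewrite /eball /= -(scale0r (0 : V)) enormZ normr0 mul0r ltW.
have [w w1 hw] := separation cvK1 coK1 K10 nKq.
have ww : dot w w = 1 by rewrite -enorm_sqr w1 expr1n.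
have z0r : dot (r *: w) (r *: w) = r ^+ 2 by rewrite !(dotZl, dotZr) ww; ring.
(* The half-space keeps all of [K1] at distance at least [r - (1 - e) * (r + s) >= eta] from
   [r *: w], at any depth; 1 is an arbitrary choice. *)
have av : avoids K1 rho (r *: w) eta 1.
  move=> x K1x _; have h1 := hw _ K1x.
  have h2 : dot q w <= (1 - e) * rho by apply: le_trans (dot_le_enorm _ _) _; rewrite w1 mulr1.
  have h3 : dot (r *: w - x) w <= enorm (r *: w - x).
    by apply: le_trans (dot_le_enorm _ _) _; rewrite w1 mulr1.
  rewrite -[enorm (x - _)]enormN opprB; apply: le_trans h3.
  rewrite dotDl dotNl dotZl ww mulr1 /eta.
  have rho' : rho <= r + s by rewrite ltW.
  have : (1 - e) * rho <= (1 - e) * (r + s) by rewrite ler_wpM2l// subr_ge0 ltW.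
  have : 0 <= e * s by rewrite mulr_ge0// ltW.
  lra.
have rho2 : rho <= 2 * r by rewrite (le_trans (ltW rhos))// /r; lra.
have [K2 [[bK2 wK2 cK2 K2r] _ azs]] := hd1 c rho _ K1 rho2 z0r bK1 cK1 K1r av.
have rho0 : 0 < rho by exact: lt_le_trans rrho.
have rhos' : rho <= r + s by exact: ltW.
have small x : K2 x -> dot x x <= rho ^+ 2 - d ^+ 2.
  move=> K2x; rewrite leNgt; apply/negP => hx.
  have xr : enorm x <= rho := K2r _ K2x.
  have xd : r - d <= enorm x.
    rewrite -ler_sqr ?nnegrE ?enorm_ge0//; last by lra.
    by rewrite enorm_sqr; apply: le_trans (ltW hx); nra.
  have x0 : 0 < enorm x by lra.
  have [|z zzs xz] := net ((r / enorm x) *: x).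
    by rewrite !(dotZl, dotZr) -enorm_sqr; field; rewrite gt_eqF.
  have h1 : eta' <= enorm (x - z) by apply: (azs z zzs) => //; nra.
  have h2 : enorm (x - z) <= enorm (x - (r / enorm x) *: x) + enorm ((r / enorm x) *: x - z).
    by rewrite -{1}(subrK ((r / enorm x) *: x) x) -addrA enormD.
  have h3 : enorm (x - (r / enorm x) *: x) = `|enorm x - r|.
    rewrite -{1}[x]scale1r -scalerBl enormZ -{2}[enorm x]ger0_norm ?enorm_ge0// -normrM.
    by congr `|_|; field; rewrite gt_eqF.
  have h4 : `|enorm x - r| <= eta' / 4 by rewrite ler_norml; lra.
  lra.
pose r2 := Num.sqrt (rho ^+ 2 - d ^+ 2).
have r2p : 0 <= rho ^+ 2 - d ^+ 2 by nra.
have r2r : r2 < r.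
  rewrite -ltr_sqr ?nnegrE ?sqrtr_ge0 ?ltW// sqr_sqrtr//.
  have : rho ^+ 2 <= (r + s) ^+ 2 by rewrite ler_sqr ?nnegrE//; lra.
  have : s * s <= s * r by rewrite ler_pM2l.
  have : 0 < d ^+ 2 by rewrite exprn_gt0.
  lra.
have : r <= r2.
  apply: ge_inf; first by exists c.
  exists K2; split=> //; first exact: worse_trans wK2.
  by move=> x /small; rewrite /eball /= enorm_le ?sqrtr_ge0// sqr_sqrtr.
by rewrite leNgt r2r.
Qed.

End Rounding.

(** * Dilations, translations and the inner ball *)

Section Transport.
Variables (R : realType) (n m : nat).
Notation V := 'rV[R]_n.

Lemma polytope_scale (c : R) (P : set V) : polytope_le m P -> polytope_le m (( *:%R c) @` P).
Proof.
move=> [k [v [km ->]]]; exists k, (fun i => c *: v i); split=> //.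
apply/seteqP; split=> x.
  move=> [_ [l [l0 [l1 ->]]] <-]; exists l; split=> //; split=> //.
  by rewrite scaler_sumr; apply: eq_bigr => i _; rewrite !scalerA mulrC.
move=> [l [l0 [l1 ->]]]; exists (\sum_i l i *: v i); first by exists l.
by rewrite scaler_sumr; apply: eq_bigr => i _; rewrite !scalerA mulrC.
Qed.

Lemma polytope_translate (w : V) (P : set V) : polytope_le m P -> polytope_le m ((fun x => x + w) @` P).
Proof.
move=> [k [v [km ->]]]; exists k, (fun i => v i + w); split=> //.
have e (l : 'I_k -> R) : \sum_i l i = 1 -> \sum_i l i *: (v i + w) = \sum_i l i *: v i + w.
  move=> l1; under eq_bigr do rewrite scalerDr.
  by rewrite big_split /= -scaler_suml l1 scale1r.
apply/seteqP; split=> x.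
  by move=> [_ [l [l0 [l1 ->]]] <-]; exists l; rewrite e.
by move=> [l [l0 [l1 ->]]]; exists (\sum_i l i *: v i); [exists l | rewrite e].
Qed.

Lemma sym_scale (c : R) (P : set V) : sym_about 0 P -> sym_about 0 (( *:%R c) @` P).
Proof.
move=> sP _ [x Px <-]; exists (- x); last by rewrite scaler0 sub0r scalerN.
by have := sP _ Px; rewrite scaler0 sub0r.
Qed.

Lemma sym_translate (o w : V) (P : set V) : sym_about o P -> sym_about (o + w) ((fun x => x + w) @` P).
Proof.
move=> sP _ [x Px <-]; exists (2 *: o - x); first exact: sP.
by apply/rowP => i; rewrite !mxE; ring.
Qed.

Lemma convex_translate (w : V) (P : set V) : convex_set P -> convex_set ((fun x => x + w) @` P).
Proof.
move=> cP _ _ t [x Px <-] [y Py <-] t0 t1; exists (t *: x + (1 - t) *: y); first exact: cP.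
by apply/rowP => i; rewrite !mxE; ring.
Qed.

Lemma compact_translate (w : V) (P : set V) : compact P -> compact ((fun x => x + w) @` P).
Proof.
move=> coP; apply: continuous_compact => //; apply: continuous_subspaceT.
apply: (@lipschitz_continuous R _ _ _ 1) => x y.
by rewrite mul1r opprD addrACA subrr addr0.
Qed.

(** [y] is the midpoint of [x0 + 2 *: y], close to the interior point [x0], and of [- x0]. *)
Lemma sym_interior_eball (K : set V) : convex_set K -> sym_about 0 K ->
  interior K !=set0 -> exists2 c, 0 < c & eball c `<=` K.
Proof.
move=> cK sK [x0 /nbhs_normP [e /= e0 eK]].
exists (e / 4); first by rewrite divr_gt0.
move=> y yc.
have K1 : K (x0 + 2 *: y).
  apply: eK => /=; rewrite opprD addrA subrr sub0r normrN normrZ ger0_norm//.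
  by have := norm_le_enorm y; move: yc; rewrite /eball /=; lra.
have K2 : K (- x0).
  have /sK : K x0 by apply: eK => /=; rewrite subrr normr0.
  by rewrite scaler0 sub0r.
have := cK _ _ 2^-1 K1 K2; rewrite invr_ge0 invf_le1// ler1n => /(_ (ler0n _ _) erefl).
by congr K; apply/rowP => i; rewrite !mxE; field.
Qed.

End Transport.

(** * Comparison of the ratios and passage to the limit *)

Lemma bernoulli_le (R : realType) (e : R) n : 0 <= e -> e <= 1 -> 1 - n%:R * e <= (1 - e) ^+ n.
Proof.
move=> e0 e1; elim: n => [|n IH]; first by rewrite mul0r subr0 expr0.
rewrite exprS; apply: (@le_trans _ _ ((1 - e) * (1 - n%:R * e))); last by rewrite ler_wpM2l// subr_ge0.
rewrite -natr1; have : 0 <= n%:R * (e * e) by rewrite !mulr_ge0.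
lra.
Qed.

(** [P] dilated by [(1 - e) * rho] fits into the rounded body and yields a polytope in [K] of at
    least that volume, while [K] has at most the volume of the ball of radius [rho]. The powers of
    [rho] cancel. *)
Lemma psi_lower (R : realType) n m (K P : set 'rV[R]_n.+1) (o : 'rV[R]_n.+1) (e : R) :
  convex_body K -> sym_about o K -> 0 < e -> e < 1 ->
  polytope_le m P -> P `<=` @unit_ball R n.+1 -> sym_about 0 P ->
  (((1 - e) ^+ n.+1 * (fine (vol P) / fine (vol (@unit_ball R n.+1))))%:E <= psi m K o)%E.
Proof.
move=> [cK coK iK] sK e0 e1 plP; rewrite unit_ballE => PB sP.
pose T (w x : 'rV[R]_n.+1) : 'rV[R]_n.+1 := x + w.
pose K0 : set 'rV[R]_n.+1 := T (- o) @` K.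
have bK0 : sym_body K0.
  split; [exact: convex_translate | exact: compact_translate |].
  by have := @sym_translate R _ o (- o) _ sK; rewrite subrr.
have [cK0 coK0 sK0] := bK0.
have [c c0 cK0'] : exists2 c, 0 < c & eball c `<=` K0.
  apply: sym_interior_eball => //; case: iK => x0 /nbhs_normP [d /= d0 dK].
  exists (x0 - o); apply: (iffRL (@nbhs_normP R 'rV[R]_n.+1 (x0 - o) K0)); exists d => //= y xy; exists (y + o); last by rewrite /T addrK.
  by apply: dK => /=; rewrite opprD addrA addrAC.
have [K' [rho [rho0 [cK' coK' sK'] [vK hK] K'1 K'2]]] := rounding m c0 e0 e1 bK0 cK0'.
have e10 : 0 < 1 - e by rewrite subr_gt0.
have er0 : 0 < (1 - e) * rho by rewrite mulr_gt0.
have eballS (r : R) : 0 < r -> eball r = ( *:%R r) @` (eball 1 : set 'rV[R]_n.+1).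
  move=> r0; apply/seteqP; split=> x.
    move=> xr; exists (r^-1 *: x); last by rewrite scalerA divff ?gt_eqF// scale1r.
    by rewrite /eball /= enormZ gtr0_norm ?invr_gt0// mulrC ler_pdivrMr// mul1r.
  by move=> [y y1 <-]; rewrite /eball /= enormZ gtr0_norm// -[leRHS]mulr1 ler_pM2l.
have volB (r : R) : 0 < r -> vol (eball r : set 'rV[R]_n.+1) = ((r ^+ n.+1)%:E * vol (eball 1 : set 'rV[R]_n.+1))%E.
  by move=> r0; rewrite eballS// vol_scale.
pose P' : set 'rV[R]_n.+1 := ( *:%R ((1 - e) * rho)) @` P.
have P'K : P' `<=` K'.
  by apply: subset_trans K'1; rewrite eballS//; apply: image_subset.
have [Q0 [plQ0 Q0K sQ0 PQ0]] := hK P' (polytope_scale _ plP) (sym_scale sP) P'K.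
pose Q : set 'rV[R]_n.+1 := T o @` Q0.
have TK : T o @` K0 = K.
  rewrite /K0 image_comp (_ : _ \o _ = id) ?image_id//.
  by apply/funext => x; rewrite /T /= subrK.
have QK : Q `<=` K by rewrite -TK; apply: image_subset.
have sQ : sym_about o Q by have := @sym_translate R _ 0 o _ sQ0; rewrite add0r.
have vKE : vol K = vol K0 by rewrite /K0 vol_translate.
have vQE : vol Q = vol Q0 by rewrite /Q vol_translate.
apply: (@le_trans _ _ (fine (vol Q) / fine (vol K))%:E); last first.
  by apply: ereal_sup_ubound; exists Q; split=> //; exact: polytope_translate.
have coPl (S : set 'rV[R]_n.+1) : polytope_le m S -> compact S.
  by move=> [k [v [_ ->]]]; exact: conv_hull_compact.
have [_ eP fP] := compact_vol (coPl _ plP).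
have [_ eQ fQ] := compact_vol (coPl _ plQ0).
have [_ eB fB] := compact_vol (@eball_compact R n.+1 1).
have [_ eK fK0] := compact_vol coK0.
rewrite vKE vQE lee_fin.
have volge0 (S : set 'rV[R]_n.+1) : compact S -> 0 <= fine (vol S).
  by move=> /compact_vol [_ -> _]; rewrite fine_ge0.
set p := fine (vol P); set b := fine (vol (eball 1)).
set q := fine (vol Q0); set k := fine (vol K0).
have p0 : 0 <= p by exact/volge0/coPl.
have b0 : 0 <= b by exact/volge0/eball_compact.
have q0 : 0 <= q by exact/volge0/coPl.
have k0 : 0 <= k by exact: volge0.
have pq : ((1 - e) * rho) ^+ n.+1 * p <= q.
  by move: PQ0; rewrite vol_scale// -(fineK fP) -(fineK fQ) -EFinM lee_fin.
have kb : k <= rho ^+ n.+1 * b.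
  have := le_trans vK (vol_mono K'2); rewrite volB// -(fineK fK0) -(fineK fB) -EFinM lee_fin; exact.
have ck : c ^+ n.+1 * b <= k.
  by have := vol_mono cK0'; rewrite volB// -(fineK fK0) -(fineK fB) -EFinM lee_fin.
(* Division by 0 yields 0, so for [b = 0] the left side vanishes. *)
have [bz|bn0] := eqVneq b 0; first by rewrite bz invr0 !mulr0 divr_ge0.
have bp : 0 < b by rewrite lt_neqAle eq_sym bn0.
have kp : 0 < k by apply: lt_le_trans ck; rewrite mulr_gt0// exprn_gt0.
rewrite mulrA ler_pdivrMr// mulrAC ler_pdivlMr//.
apply: (@le_trans _ _ ((1 - e) ^+ n.+1 * p * (rho ^+ n.+1 * b))).
  by rewrite ler_wpM2l// mulr_ge0// exprn_ge0// ltW.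
rewrite mulrA ler_pM2r//; apply: le_trans pq; rewrite exprMn mulrAC lexx//.
Qed.

Theorem theorem6 (R : realType) (n : nat) (K : set 'rV[R]_n) (o : 'rV[R]_n)
  (m : nat) :
  convex_body K -> sym_about o K ->
  (psi m (@unit_ball R n) 0 <= psi m K o)%E.
Proof.
case: n K o => [|n] K o bK sK.
  (* In dimension 0 the space is a point, and [K], being nonempty, is the unit ball. *)
  have o0 : o = 0 by apply/rowP => -[].
  suff -> : K = @unit_ball R 0 by rewrite o0.
  have [_ _ [x /interior_subset Kx]] := bK.
  apply/seteqP; split=> y _; first by rewrite /unit_ball /= big_ord0.
  by rewrite (_ : y = x)//; apply/rowP => -[].
apply: ge_ereal_sup => _ [P [plP PB sP ->]].
have coP : compact P by have [k [v [_ ->]]] := plP; exact: conv_hull_compact.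
set a := fine _ / fine _.
have a0 : 0 <= a.
  rewrite /a unit_ballE; have [_ -> _] := compact_vol coP.
  by have [_ -> _] := compact_vol (@eball_compact R n.+1 1); rewrite divr_ge0// fine_ge0.
have h e : 0 < e -> e < 1 -> (((1 - e) ^+ n.+1 * a)%:E <= psi m K o)%E.
  by move=> e0 e1; exact: psi_lower.
apply/lee_addgt0Pr => d d0.
(* By [bernoulli_le] the loss is at most [n.+1%:R * e * a <= d]; the summand 1 keeps the denominator
   positive. *)
pose e := Num.min (2^-1) (d / (n.+1%:R * a + 1)).
have na : 0 < n.+1%:R * a + 1 by rewrite ltr_wpDl// mulr_ge0.
have e0 : 0 < e by rewrite lt_min invr_gt0 ltr0n divr_gt0.
have e1 : e < 1 by rewrite gt_min invf_lt1// ltr1n.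
have ed : e * (n.+1%:R * a + 1) <= d by rewrite -ler_pdivlMr// ge_min lexx orbT.
apply: (@le_trans _ _ (((1 - e) ^+ n.+1 * a)%:E + d%:E)%E); last by rewrite leeD2r// h.
rewrite -EFinD lee_fin.
have : (1 - n.+1%:R * e) * a <= (1 - e) ^+ n.+1 * a.
  by rewrite ler_wpM2r// bernoulli_le// ltW.
lra.
Qed.
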